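(* Let $d\ge 3$ and $k\ge 1$ be integers, and let $T\in \mathscr{S}_k^d$. Then $\operatorname{Vol}(T)=\frac{1}{d!}(dk+1)$ if and only if $T\simeq S_d(k)$, where $$S_d(k)=\operatorname{conv}\Big(e_1,\dots,e_d,\,-k\sum_{i=1}^d e_i\Big)\subset\mathbb{R}^d .$$
   Context: $e_i$ denotes the $i$-th standard unit vector of $\mathbb{R}^d$, and $\operatorname{Vol}$ is $d$-dimensional Lebesgue volume. A lattice $d$-simplex is a nondegenerate ($d$-dimensional) simplex in $\mathbb{R}^d$ all of whose $d+1$ vertices lie in $\mathbb{Z}^d$. A lattice polytope $P$ is clean if the only points of $\mathbb{Z}^d$ on its boundary $\partial P$ are its vertices. $\mathscr{S}_k^d$ is the collection of clean lattice $d$-simplices in $\mathbb{R}^d$ with exactly $k$ points of $\mathbb{Z}^d$ in their interior. A unimodular transformation is an affine map $f(v)=v\cdot M+u$ (row vectors) with $u\in\mathbb{Z}^d$ and $M$ a $d\times d$ integer matrix with $\det M=\pm1$. Lattice $d$-polytopes $P_1,P_2$ are equivalent, written $P_1\simeq P_2$, if $P_1=f(P_2)$ for some unimodular transformation $f$. *)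

(* Defs.v *)
From HB Require Import structures.
From mathcomp Require Import all_boot all_order all_algebra.
From mathcomp Require Import all_classical all_reals all_analysis.
Import Order.TTheory GRing.Theory Num.Theory.
Import numFieldNormedType.Exports.

Set Implicit Arguments.
Unset Strict Implicit.
Unset Printing Implicit Defensive.

Local Open Scope classical_set_scope.
Local Open Scope ring_scope.

Section lebesgue_tuple.
Context {R : realType}.
Implicit Type n : nat.

Let T := measurableTypeR R.

Let cons_tuple n (p : T * n.-tuple T) : n.+1.-tuple T := [tuple of p.1 :: p.2].

Let measurable_cons_tuple n : measurable_fun setT (@cons_tuple n).
Proof. exact: measurable_cons. Qed.

Let uncons_tuple n (t : n.+1.-tuple T) : T * n.-tuple T :=
  (thead t, [tuple of behead t]).

Let measurable_uncons_tuple n : measurable_fun setT (@uncons_tuple n).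
Proof.
apply/measurable_fun_pair; last exact: measurable_behead.
exact: measurable_tnth.
Qed.

Let cons_tupleK n : cancel (@cons_tuple n) (@uncons_tuple n).
Proof.
by case=> x t; rewrite /uncons_tuple theadE; congr pair; apply/val_inj.
Qed.

Section cons_measure.
Variables (n : nat) (m : {sigma_finite_measure set (n.-tuple T) -> \bar R}).

Definition cons_measure : set (n.+1.-tuple T) -> \bar R :=
  pushforward (@lebesgue_measure R \x m)%E
    (fun p : T * n.-tuple T => [tuple of p.1 :: p.2]).

HB.instance Definition _ := Measure.copy cons_measure
  (measure_function_pushforward__canonical__measure_function_Measure
    (@lebesgue_measure R \x m)%E (@measurable_cons_tuple n)).

Let cons_measure_sigma_finite : sigma_finite setT cons_measure.
Proof.
have /sigma_finiteP[F [FT ndF Foo]] := sigma_finiteT (@lebesgue_measure R).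
have /sigma_finiteP[G [GT ndG Goo]] := sigma_finiteT m.
exists (fun i => @uncons_tuple n @^-1` (F i `*` G i)).
  apply/seteqP; split=> // t _.
  have : [set: T] (uncons_tuple t).1 by [].
  have : [set: n.-tuple T] (uncons_tuple t).2 by [].
  rewrite FT GT => -[j _ Gj] [i _ Fi]; exists (maxn i j) => //; split.
    by move: Fi; exact/subsetPset/ndF/leq_maxl.
  by move: Gj; exact/subsetPset/ndG/leq_maxr.
move=> i; have [mF Fioo] := Foo i; have [mG Gioo] := Goo i; split.
  rewrite -[X in measurable X]setTI; apply: measurable_uncons_tuple => //.
  exact: measurableX.
rewrite /cons_measure /pushforward -/(@cons_tuple n) -comp_preimage.
rewrite (_ : _ \o _ = id); last by apply/funext => x /=; rewrite cons_tupleK.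
by rewrite product_measure1E// lte_mul_pinfty// ge0_fin_numE.
Qed.

HB.instance Definition _ := Measure_isSigmaFinite.Build _ _ _ cons_measure
  cons_measure_sigma_finite.

End cons_measure.

(* The n-fold product of the Lebesgue measure of the line, as a Borel measure
   on n-tuples; on 0-tuples it is the unit mass. *)
Fixpoint lebesgue_tuple n : {sigma_finite_measure set (n.-tuple T) -> \bar R} :=
  match n with
  | 0 => \d_([tuple])
  | n'.+1 => cons_measure (lebesgue_tuple n')
  end.

Lemma lebesgue_tuple_box n (B : 'I_n -> set T) :
  (forall i, measurable (B i)) ->
  lebesgue_tuple n [set t | forall i, B i (tnth t i)] =
  (\prod_(i < n) lebesgue_measure (B i))%E.
Proof.
elim: n B => [|n IHn] B mB.
  by rewrite big_ord0 /= diracE mem_set // => -[].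
rewrite big_ord_recl -IHn; last by move=> i; exact: mB.
rewrite /= /cons_measure /pushforward /=.
rewrite -product_measure1E //; last first.
  rewrite (_ : [set t | _] =
      \bigcap_(i in [set: 'I_n]) ((@tnth n T ^~ i) @^-1` B (lift ord0 i))).
    apply: fin_bigcap_measurable; first exact: finite_finset.
    move=> i _; rewrite -[X in measurable X]setTI.
    exact: measurable_tnth.
  by apply/seteqP; split=> [t Bt i _|t Bt i] /=; exact: Bt.
congr product_measure1; apply/seteqP; split=> [[x t] /= Bxt|[x t] [/= Bx Bt] i].
  split=> /= [|i]; first by have := Bxt ord0.
  by have := Bxt (lift ord0 i); rewrite /cons_tuple /= tnthS.
have [j ->|->] := unliftP ord0 i; last by [].
by rewrite /cons_tuple /= tnthS.
Qed.

End lebesgue_tuple.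

Section polytopes.
Context {R : realType} {d : nat}.
Implicit Types (A P T : set 'rV[R]_d) (k : nat).

Definition Vol A : \bar R :=
  lebesgue_tuple d [set t | A (\row_(i < d) tnth t i)].

Definition lattice : set 'rV[R]_d :=
  [set x | forall i, x 0 i \is a Num.int].

Definition convex_hull A : set 'rV[R]_d :=
  smallest (@convex_set R 'rV[R]_d) A.

Definition affinely_independent n (v : 'I_n -> 'rV[R]_d) :=
  forall c : 'I_n -> R,
    \sum_i c i = 0 -> \sum_i c i *: v i = 0 -> forall i, c i = 0.

Definition d_simplex T :=
  exists2 v : 'I_d.+1 -> 'rV[R]_d,
    affinely_independent v & T = convex_hull (range v).

(* The vertices of a polytope are its extreme points; for a simplex these are
   the affinely independent points that span it. *)
Definition vertices P : set 'rV[R]_d :=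
  [set x | P x /\ forall (y z : 'rV[R]_d) (t : R), P y -> P z -> 0 < t < 1 ->
                    x = t *: y + (1 - t) *: z -> y = x /\ z = x].

Definition boundary P : set 'rV[R]_d := closure P `\` interior P.

Definition lattice_simplex T := d_simplex T /\ vertices T `<=` lattice.

Definition clean P := boundary P `&` lattice `<=` vertices P.

Definition clean_lattice_simplices k : set (set 'rV[R]_d) :=
  [set T | [/\ lattice_simplex T, clean T &
               (interior T `&` lattice #= `I_k)%card]].

Definition unimodular_map (M : 'M[int]_d) (u : 'rV[int]_d) (v : 'rV[R]_d) :=
  v *m map_mx intr M + map_mx intr u.

Definition equivalent P1 P2 :=
  exists (M : 'M[int]_d) (u : 'rV[int]_d),
    (\det M = 1 \/ \det M = -1) /\ P1 = unimodular_map M u @` P2.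

End polytopes.

Definition simplex_S (R : realType) (d k : nat) : set 'rV[R]_d :=
  convex_hull (range (fun i : 'I_d => delta_mx 0 i : 'rV[R]_d) `|`
        [set - (k%:R *: \sum_(i < d) (delta_mx 0 i : 'rV[R]_d))]).
Arguments simplex_S : clear implicits.

(* Main.v *)
Require Import Defs.
From mathcomp Require Import all_boot all_order fingroup perm all_algebra.
From mathcomp Require Import all_classical all_reals all_analysis.
From mathcomp Require Import measurable_realfun zify ring.
Import Order.TTheory GRing.Theory Num.Theory.
Import numFieldNormedType.Exports.

(** Let T be a clean lattice d-simplex with vertices v_0, ..., v_d, let k be the
    number of its interior lattice points, and put N = d! Vol(T). Barycentric
    coordinates of lattice points are multiples of 1/N; taken modulo 1 and
    multiplied by N, they form a subgroup G of (Z/N)^(d+1) of order at most N.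
    The height of a in G is the sum of the representatives of its coordinates in
    [0, N), divided by N. Elements of height 1 are the lattice points of T other
    than the vertices; as T is clean these are the k interior points, all their
    coordinates are positive, and their opposites have height d.

    Lower bound. Let L_m be the set of elements of height at most m. If
    0 <= m < d, the sum of L_m and of the set of 0 and all points of height 1
    lies in L_(m+1), and 0 has only the trivial representation in it, because
    opposites of the points have height d. Scherk's theorem ([scherk]) then
    gives |L_(m+1)| >= |L_m| + k, whence N >= |G| >= d k + 1
    ([card_residue_group]).

    Equality. If N = d k + 1, every inclusion used is an equality: each nonzero
    element of G is a sum of points of height 1 without carries
    ([height1_summand]), so it has no zero coordinate, and each coordinate maps
    G bijectively onto Z/N. Next, subdivide T at an interior lattice point p.
    The cone over the facet opposite to v_i has normalised volume p_i, and the
    lower bound applies to it. A point q that lies in m of these cones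
    contributes m (d + 1 - m) >= d to the sum of the d + 1 bounds, and that sum
    is exactly N; therefore m is 1 or d, and each cone attains its bound
    ([cone_extremal]). A cone in which no point other than p lies in a second
    one is again extremal ([cut_extremal]).

    This rigidity determines G. Fix an index i0, let p be the point of
    coordinate 1 there, and let s be the next smallest coordinate of a point q
    at i0 (if k = 1, there is none, and all coordinates of p are 1). Then q =
    s p, exactly s - 1 coordinates wrap around once modulo N, and s - 1 is 1 or
    d. If s = d + 1, the other coordinates of p are all equal to k, and those of
    - d p are equal to 1. If s = 2, the cone at p of the wrapping index is
    extremal with fewer points, and induction on k applies to it
    ([double_step]). In all cases G contains an element all of whose coordinates
    but one are 1 ([extremal_standard]). Multiplying it by k gives a lattice
    point Z with N Z = v_j + k * (sum of the other vertices), which is how the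
    origin sits in S_d(k), so T is equivalent to S_d(k)
    ([equivalent_of_center]).

    The volume enters through d! Vol(T) = |det(v_i - v_0)| ([Vol_simplex]),
    which follows from the linear change of variables for the iterated Lebesgue
    measure ([scales_affine]); it also gives the converse, because the
    determinant for S_d(k) is d k + 1. *)

Set Implicit Arguments.
Unset Strict Implicit.
Unset Printing Implicit Defensive.

Local Open Scope classical_set_scope.
Local Open Scope ring_scope.

(** * Scherk's theorem *)

Definition sumset (M : finZmodType) (A B : {set M}) : {set M} :=
  [set a + b | a in A, b in B]%SET.

(** Induction on #|B|. If A + B = A, then B = 0 because 0 is in A. Otherwise
    some a + b is not in A; Dyson's transform moves the elements of a + B that
    are not in A from B into A. It preserves the total size and creates no new
    sum, as (a + z) + y = (a + y) + z. If such a sum vanishes, then z = 0, which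
    contradicts that a + z is not in A. *)
Lemma scherk (M : finZmodType) (A B : {set M}) :
  0 \in A -> 0 \in B ->
  (forall a b, a \in A -> b \in B -> a + b = 0 -> b = 0) ->
  (#|A| + #|B| <= #|sumset A B|.+1)%N.
Proof.
have [n] := ubnP #|B|; elim: n A B => // n IHn A B leBn A0 B0 uniq0.
have subAS : A \subset sumset A B.
  apply/fintype.subsetP => a aA; rewrite -[a]addr0. apply: imset2_f => //.
have [/exists_inP[a aA /exists_inP[b bB abA]]|noab] :=
    boolP [exists a in A, exists b in B, a + b \notin A]; last first.
  suff BE : B = [set 0]%SET.
    have -> : #|B| = 1%N by rewrite BE cards1.
    by rewrite addn1 ltnS subset_leq_card.
  apply/setP => b; rewrite inE; apply/idP/eqP => [bB|-> //].
  have AbA : [set x + b | x in A]%SET = A.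
    apply/eqP; rewrite eqEcard card_imset ?leqnn ?andbT; last exact: addIr.
    apply/fintype.subsetP => _ /imsetP[x xA ->]; apply: contraNT noab => xbA.
    by apply/exists_inP; exists x => //; apply/exists_inP; exists b.
  by move: A0; rewrite -{1}AbA => /imsetP[x xA /esym]; exact: uniq0.
pose B1 := [set y in B | a + y \in A]%SET.
pose B2 := [set y in B | a + y \notin A]%SET.
pose A1 := (A :|: [set a + y | y in B2])%SET.
have ltB1B : (#|B1| < #|B|)%N.
  apply: proper_card; apply/properP; split.
    by apply/fintype.subsetP => y; rewrite inE => /andP[].
  by exists b => //; rewrite inE bB.
have cardA1 : #|A1| = (#|A| + #|B2|)%N.
  rewrite cardsU disjoint_setI0 ?cards0 ?subn0.
    by rewrite card_imset //; exact: addrI.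
  apply/pred0P => x /=; apply/negP => /andP[xA /imsetP[y]].
  by rewrite inE => /andP[_ /negP ayA] xE; apply: ayA; rewrite -xE.
have cardB : #|B| = (#|B1| + #|B2|)%N.
  rewrite -(cardsID [set y | a + y \in A]%SET B); congr (_ + _)%N.
    by apply: eq_card => y; rewrite !inE.
  by apply: eq_card => y; rewrite !inE andbC.
have sub1 : sumset A1 B1 \subset sumset A B.
  apply/fintype.subsetP => s /imset2P[x y xA1];
    rewrite inE => /andP[yB ayA] -> {s}.
  move: xA1; rewrite inE => /orP[xA|/imsetP[z]]; first exact: imset2_f.
  rewrite inE => /andP[zB _] ->; rewrite -addrA [z + y]addrC addrA.
  exact: imset2_f.
suff le1 : (#|A1| + #|B1| <= #|sumset A1 B1|.+1)%N.
  have := leq_trans le1 (subset_leq_card sub1 : (_.+1 <= _.+1)%N);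
    by rewrite cardA1 cardB; lia.
apply: IHn.
- lia.
- by rewrite inE A0.
- by rewrite inE B0 addr0.
move=> x y xA1; rewrite inE => /andP[yB ayA].
move: xA1; rewrite inE => /orP[xA|/imsetP[z]]; first exact: uniq0.
rewrite inE => /andP[zB azA] ->; rewrite -addrA [z + y]addrC addrA => ayz0.
have z0 := uniq0 _ _ ayA zB ayz0; move: azA; rewrite z0 addr0.
by rewrite aA.
Qed.

(** * Groups of fractional coordinates and their height *)

Section ResidueGroups.
Local Open Scope nat_scope.

(** The coordinates are arbitrary functions [f i] instead of the projections of
    a subgroup of (Z/N)^I, because the cones of a subdivision give groups 'I_t
    whose coordinates are multiplications by constants modulo t. *)
Record residue_group (M : finZmodType) (I : finType) (N : nat)
    (G : {set M}) (f : I -> M -> nat) : Prop := ResidueGroup {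
  rg_gt0 : (0 < N)%N;
  rg_zero : 0%R \in G;
  rg_add : forall a b, a \in G -> b \in G -> (a + b)%R \in G;
  rg_opp : forall a, a \in G -> (- a)%R \in G;
  rg_lt : forall i a, (f i a < N)%N;
  rg_addE : forall i a b, f i (a + b)%R = (f i a + f i b) %% N;
  rg_sum : forall a, a \in G -> (N %| \sum_i f i a)%N;
  rg_eq0 : forall a, a \in G -> (forall i, f i a = 0) -> a = 0%R }.

Definition height (M : finZmodType) (I : finType) (N : nat)
    (f : I -> M -> nat) (a : M) : nat := (\sum_i f i a) %/ N.

Definition height1 (M : finZmodType) (I : finType) (N : nat)
    (G : {set M}) (f : I -> M -> nat) : {set M} :=
  [set a in G | height N f a == 1]%SET.

Section ResidueGroup.
Variables (M : finZmodType) (I : finType) (N : nat).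
Variables (G : {set M}) (f : I -> M -> nat).
Hypothesis rgG : residue_group N G f.

Local Notation h := (height N f).
Local Notation H1 := (height1 N G f).

Lemma rg_zeroE i : f i 0%R = 0.
Proof.
have := rg_addE rgG i 0%R 0%R; rewrite addr0 => /eqP.
rewrite -{1}(modn_small (rg_lt rgG i 0%R)) -{1}[f i 0%R]addn0 eqn_modDl mod0n.
by rewrite eq_sym modn_small ?(rg_lt rgG) // => /eqP.
Qed.

Lemma rg_addE_cases i a b :
  f i (a + b)%R = (f i a + f i b)%N /\ (f i a + f i b < N)%N \/
  (f i (a + b)%R + N = f i a + f i b)%N.
Proof.
have faN := rg_lt rgG i a; have fbN := rg_lt rgG i b.
rewrite (rg_addE rgG); case: (ltnP (f i a + f i b) N) => [lt|le].
  by left; rewrite modn_small.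
by right; rewrite -{1}(subnK le) modnDr modn_small; lia.
Qed.

Lemma rg_mulE i a n : f i (a *+ n)%R = (n * f i a) %% N.
Proof.
elim: n => [|n IHn]; first by rewrite mulr0n rg_zeroE mod0n.
by rewrite mulrS (rg_addE rgG) IHn modnDmr mulSn.
Qed.

Lemma rg_mul a n : a \in G -> (a *+ n)%R \in G.
Proof.
move=> aG; elim: n => [|n IHn]; first by rewrite mulr0n (rg_zero rgG).
by rewrite mulrS (rg_add rgG).
Qed.

Lemma rg_oppE i a : f i (- a)%R = (if f i a == 0 then 0 else N - f i a)%N.
Proof.
have faN := rg_lt rgG i a; have fbN := rg_lt rgG i (- a)%R.
have := rg_addE_cases i a (- a)%R; rewrite subrr rg_zeroE.
by case: eqP => [->|]; lia.
Qed.

Lemma rg_subE i a b :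
  f i (a - b)%R = f i a + (if (f i b <= f i a)%N then 0 else N) - f i b.
Proof.
have faN := rg_lt rgG i a; have fbN := rg_lt rgG i b.
have := rg_addE_cases i a (- b)%R; rewrite rg_oppE.
by move: (f i _) (f i a) (f i b) faN fbN => x y z; case: eqP; case: (leqP z y);
  lia.
Qed.

Lemma height_sum a : a \in G -> \sum_i f i a = (h a * N)%N.
Proof. by move=> aG; rewrite /height divnK ?(rg_sum rgG). Qed.

Lemma height0 : h 0%R = 0.
Proof. by rewrite /height big1 ?div0n // => i _; rewrite rg_zeroE. Qed.

Lemma height_eq0 a : a \in G -> h a = 0%N -> a = 0%R.
Proof.
move=> aG ha; have := height_sum aG; rewrite ha mul0n => /eqP.
rewrite sum_nat_eq0 => /forallP fa0; apply: (rg_eq0 rgG) => // i.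
exact/eqP/fa0.
Qed.

Lemma rg_add_le i a b : (f i (a + b)%R <= f i a + f i b)%N.
Proof. by case: (rg_addE_cases i a b); lia. Qed.

Lemma height_add a b : a \in G -> b \in G -> (h (a + b)%R <= h a + h b)%N.
Proof.
move=> aG bG; rewrite -(leq_pmul2r (rg_gt0 rgG)) mulnDl -!height_sum //.
  by rewrite -big_split /=; apply: leq_sum => i _; exact: rg_add_le.
exact: (rg_add rgG).
Qed.

Lemma height_add_eq a b : a \in G -> b \in G -> (h a + h b <= h (a + b)%R)%N ->
  forall i, f i (a + b)%R = (f i a + f i b)%N.
Proof.
move=> aG bG; rewrite -(leq_pmul2r (rg_gt0 rgG)) mulnDl -!height_sum //;
  last first.
  exact: (rg_add rgG).
rewrite -big_split /= => le i; apply/eqP; move: i.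
have leif i : true -> (f i (a + b)%R <=
  f i a + f i b ?= iff (f i (a + b)%R == f i a + f i b))%N.
  by move=> _; split=> //; exact: rg_add_le.
have := leqif_sum leif.
move=> [le' eq'] i; have :
  (\sum_i0 f i0 (a + b)%R == \sum_i0 (f i0 a + f i0 b))%N.
  by rewrite eqn_leq le le'.
by rewrite eq' => /forallP/(_ i).
Qed.

(** A nonzero coordinate of a and that of - a add up to N. For a lattice point
    of a simplex, the right-hand side is one more than the dimension of the face
    that has the point in its relative interior. *)
Lemma height_opp a : a \in G ->
  (h a + h (- a)%R)%N = #|[set i | f i a != 0]%SET|.
Proof.
move=> aG; have aG' := rg_opp rgG aG.
apply/eqP; rewrite -(eqn_pmul2r (rg_gt0 rgG)) mulnDl -!height_sum //.
rewrite -big_split /= (bigID [pred i | f i a != 0]) /= [X in (_ + X)%N]big1;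
  last first.
  by move=> i; rewrite negbK rg_oppE => /eqP->.
rewrite addn0 (eq_bigr (fun=> N)); last first.
  move=> i; rewrite rg_oppE => /negPf->; have := rg_lt rgG i a; lia.
by rewrite sum_nat_const; apply/eqP; congr (_ * _)%N; apply: eq_card => i;
  rewrite !inE.
Qed.

Lemma height1P a : reflect (a \in G /\ \sum_i f i a = N) (a \in H1).
Proof.
rewrite inE; apply: (iffP andP) => -[aG].
  by move=> /eqP h1; split=> //; rewrite height_sum // h1 mul1n.
by move=> s1; split=> //; rewrite /height s1 divnn (rg_gt0 rgG).
Qed.

Lemma height_opp_full a : a \in H1 -> (forall i, 0 < f i a) ->
  h (- a)%R = #|I|.-1.
Proof.
move=> aH fa; have := height_opp (proj1 (height1P _ aH)).
rewrite (_ : [set i | _]%SET = [set: I]%SET); last first.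
  by apply/setP => i; rewrite !inE -lt0n fa.
by move: aH; rewrite cardsT inE => /andP[_ /eqP ->] <-.
Qed.

(** Elements of [deep m] are low enough to send [level m] into [level m.+1],
    while the opposites of the nonzero ones are too high to lie in [level m]:
    this is the hypothesis of Scherk's theorem. *)
Definition level m : {set M} := [set a in G | h a <= m]%N%SET.
Definition deep m : {set M} := 0%R |: [set a in H1 | m < h (- a)%R]%N%SET.

Lemma card_deep m : #|deep m| = (\sum_(a in H1) (m < h (- a)%R)).+1.
Proof.
rewrite cardsU1 !inE height0 andbF /= add1n; congr _.+1.
rewrite -sum1_card big_mkcond [RHS]big_mkcond; apply: eq_bigr => a _ /=.
by rewrite !inE; case: (a \in G) => //; case: (h a == 1%N) => //=; case: ltnP.
Qed.

Lemma sumset_deep m : sumset (deep m) (level m) \subset level m.+1.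
Proof.
apply/fintype.subsetP => s /imset2P[a b];
  rewrite !inE => aD /andP[bG hb] -> {s}.
case/orP: aD => [/eqP->|/andP[/andP[aG /eqP ha] _]].
  by rewrite add0r bG /= leqW.
by rewrite (rg_add rgG) //= (leq_trans (height_add aG bG)) // ha add1n.
Qed.

Lemma scherk_deep m :
  (#|level m| + \sum_(a in H1) (m < h (- a)%R) <=
    #|sumset (deep m) (level m)|)%N.
Proof.
rewrite -ltnS; apply: leq_trans (scherk _ _ _).
- by rewrite card_deep; lia.
- by rewrite !inE eqxx.
- by rewrite inE (rg_zero rgG) height0.
move=> a b; rewrite !inE => aD /andP[bG hb] /eqP.
rewrite addrC addr_eq0 => /eqP bE.
case/orP: aD => [/eqP a0|/andP[_]]; first by rewrite bE a0 oppr0.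
by rewrite -bE ltnNge hb.
Qed.

Lemma card_level m :
  (1 + \sum_(a in H1) minn m (h (- a)%R) <= #|level m|)%N.
Proof.
elim: m => [|m IHm].
  rewrite (eq_bigr (fun=> 0%N)); last by move=> a _; rewrite min0n.
  rewrite sum_nat_const muln0 addn0; apply/card_gt0P; exists 0%R.
  by rewrite inE (rg_zero rgG) height0.
apply: leq_trans (subset_leq_card (sumset_deep m)).
apply: leq_trans (scherk_deep m).
apply: leq_trans (leq_add IHm (leqnn _)).
rewrite -addnA leq_add2l -big_split /=; apply: leq_sum => a _; lia.
Qed.

Lemma height_le a : (h a <= #|I|)%N.
Proof.
rewrite /height -(leq_pmul2r (rg_gt0 rgG)).
apply: leq_trans (leq_divM _ _) _.
rewrite -sum_nat_const; apply: leq_sum => i _; exact: ltnW (rg_lt rgG _ _).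
Qed.

(** Passing from [level m] to [level m.+1] gains one element for each a of
    height 1 with m < height (- a); summed over m, this counts a as many times
    as the height of - a. *)
Lemma card_residue_group :
  (1 + \sum_(a in H1) h (- a)%R <= #|G|)%N.
Proof.
apply: leq_trans (leq_trans (card_level #|I|) _); last first.
  by apply: subset_leq_card; apply/fintype.subsetP => a; rewrite inE => /andP[].
rewrite leq_add2l; apply: leq_sum => a _.
by rewrite (minn_idPr (height_le _)).
Qed.

End ResidueGroup.

(** * The extremal case *)

(** In terms of a simplex, [xg_clean] excludes lattice points on the boundary
    other than the vertices; it gives opposites of points of height 1 the height
    #|I| - 1, so that [xg_min] is equality in [card_residue_group]. *)
Record extremal_residue_group (M : finZmodType) (I : finType) (N : nat)
    (G : {set M}) (f : I -> M -> nat) : Prop := ExtremalResidueGroup {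
  xg_residue_group : residue_group N G f;
  xg_clean : forall a i, a \in height1 N G f -> 0 < f i a;
  xg_card : #|G| = N;
  xg_min : N = (#|I|.-1 * #|height1 N G f|).+1 }.

Section Extremal.
Variables (M : finZmodType) (I : finType) (N : nat) (d : nat).
Variables (G : {set M}) (f : I -> M -> nat).
Hypothesis xgG : extremal_residue_group N G f.
Hypothesis cardI : #|I| = d.+1.

Let rgG := xg_residue_group xgG.
Local Notation h := (height N f).
Local Notation H1 := (height1 N G f).
Local Notation level := (level N G f).
Local Notation deep := (deep N G f).

Lemma card_extremal : N = (d * #|H1|).+1.
Proof. by rewrite {1}(xg_min xgG) cardI. Qed.

Lemma height1_mem a : a \in H1 -> a \in G.
Proof. by rewrite inE => /andP[]. Qed.

Lemma height1_sum a : a \in H1 -> \sum_i f i a = N.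
Proof. by move=> /(height1P rgG)[]. Qed.

Lemma height1_opp a : a \in H1 -> h (- a)%R = d.
Proof.
by move=> aH; rewrite (height_opp_full rgG aH) ?cardI // => i;
  exact: xg_clean xgG _ _ aH.
Qed.

Lemma card_level_step m : m < d ->
  #|level m| + #|H1| <= #|sumset (deep m) (level m)|.
Proof.
move=> md; apply: leq_trans (scherk_deep rgG m).
rewrite leq_add2l (eq_bigr (fun=> 1)) ?sum1_card // => a aH.
by rewrite height1_opp // md.
Qed.

Lemma card_level_min m e : m + e = d -> #|level m| + e * #|H1| <= #|G|.
Proof.
elim: e m => [|e IHe] m mde.
  rewrite addn0; apply: subset_leq_card; apply/fintype.subsetP => a.
  by rewrite inE => /andP[].
have md : m < d by rewrite -mde; lia.
apply: leq_trans (IHe m.+1 _); last lia.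
have := card_level_step md.
have := subset_leq_card (sumset_deep rgG m); lia.
Qed.

Lemma card_levelE m : m <= d -> #|level m| = (m * #|H1|).+1.
Proof.
move=> md; have := card_level_min (subnKC md).
have dE : d * #|H1| = m * #|H1| + (d - m) * #|H1| by rewrite -mulnDl subnKC.
rewrite (xg_card xgG) [X in _ <= X]card_extremal dE => le.
have := card_level rgG m; rewrite (eq_bigr (fun=> m)).
  by rewrite sum_nat_const mulnC; lia.
by move=> a aH; rewrite height1_opp // (minn_idPl md).
Qed.

Lemma level_sumset m : m < d -> level m.+1 = sumset (deep m) (level m).
Proof.
move=> md; apply/esym/eqP; rewrite eqEcard (sumset_deep rgG) /=.
have := card_level_step md;
  rewrite (card_levelE md) (card_levelE (ltnW md)) mulSn.
by move: (#|sumset _ _|) => u; rewrite addnC addnS.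
Qed.

Lemma height_le_dim a : a \in G -> h a <= d.
Proof.
have sub : level d \subset G by apply/fintype.subsetP => x;
  rewrite inE => /andP[].
have /eqP levelE : level d == G.
  by rewrite eqEcard sub card_levelE // (xg_card xgG) [X in X <= _]card_extremal
    leqnn.
by rewrite -levelE inE => /andP[].
Qed.

(** Equality makes [level m.+1] the whole sumset of [deep m] and [level m]. An
    element of height m + 1 is thus a + b with a of height 1 and b of height at
    most m, and a carry in a + b would lower the height. *)
Lemma height1_summand x : x \in G -> x != 0%R ->
  exists a b, [/\ a \in H1, b \in G, x = (a + b)%R &
                  forall i, f i x = f i a + f i b].
Proof.
move=> xG x0; case hx : (h x) => [|m].
  by rewrite (height_eq0 rgG xG hx) eqxx in x0.
have md : m < d by rewrite -hx height_le_dim.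
have : x \in level m.+1 by rewrite inE xG hx /=.
rewrite level_sumset // => /imset2P[a b]; rewrite !inE.
move=> /orP[/eqP -> /andP[_ hb] xE|/andP[/andP[aG ha] _] /andP[bG hb] xE].
  by move: hb; rewrite xE add0r in hx *; rewrite hx ltnn.
exists a, b; rewrite inE aG ha bG; split=> //; rewrite xE.
by apply: (height_add_eq rgG) => //; rewrite -xE hx (eqP ha) add1n ltnS.
Qed.

Lemma coord_gt0 x i : x \in G -> x != 0%R -> 0 < f i x.
Proof.
move=> xG x0; have [a [b [aH bG _ ->]]] := height1_summand xG x0.
by rewrite addn_gt0 (xg_clean xgG).
Qed.

Lemma coord_inj i a b : a \in G -> b \in G -> f i a = f i b -> a = b.
Proof.
move=> aG bG fab; apply/eqP; rewrite -subr_eq0; apply/negPn/negP => ab0.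
have := @coord_gt0 _ i _ ab0; rewrite (rg_subE rgG) fab leqnn addn0 subnn.
by move=> /(_ (rg_add rgG aG (rg_opp rgG bG))).
Qed.

Lemma coord_surj i s : s < N -> exists2 a, a \in G & f i a = s.
Proof.
move=> sN; pose g a := Ordinal (rg_lt rgG i a).
have ginj : {in G &, injective g}.
  by move=> a b aG bG /(congr1 val) /=; exact: coord_inj.
have : Ordinal sN \in [set g a | a in G]%SET.
  suff -> : [set g a | a in G]%SET = [set: 'I_N]%SET by rewrite inE.
  apply/eqP; rewrite eqEcard finset.subsetT cardsT card_ord card_in_imset //.
  by rewrite (xg_card xgG) leqnn.
by move=> /imsetP[a aG /(congr1 val) /= ->]; exists a.
Qed.

Lemma coord1_height1 i a : a \in G -> f i a = 1 -> a \in H1.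
Proof.
move=> aG fa1; have a0 : a != 0%R.
  by apply: contra_eqN fa1 => /eqP->; rewrite (rg_zeroE rgG).
have [x [y [xH yG aE fE]]] := height1_summand aG a0.
have fx := xg_clean xgG i xH.
suff y0 : y = 0%R by rewrite aE y0 addr0.
apply/eqP/negPn/negP => /(coord_gt0 i yG); have := fE i; lia.
Qed.

(** * Star subdivision at an interior point *)

(** The star subdivision of a simplex at p has one cone for each index i,
    spanned by p and the facet opposite to the vertex i; the point q lies in it
    exactly when i minimises q_i / p_i. *)
Definition argmin_ratio (p q : M) : {set I} :=
  [set i | [forall j, f i q * f j p <= f j q * f i p]]%SET.

Lemma argmin_ratioP p q i :
  reflect (forall j, f i q * f j p <= f j q * f i p) (i \in argmin_ratio p q).
Proof. by rewrite inE; apply: forallP. Qed.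

Lemma argmin_lt p q i : p \in H1 -> q \in H1 -> q != p ->
  i \in argmin_ratio p q -> f i q < f i p.
Proof.
move=> pH qH qp /argmin_ratioP le.
have : \sum_j f i q * f j p <= \sum_j f j q * f i p by apply: leq_sum.
rewrite -big_distrr -big_distrl /= !height1_sum // mulnC leq_pmul2l
  ?(rg_gt0 rgG) //.
rewrite leq_eqVlt => /orP[/eqP/(coord_inj (height1_mem qH) (height1_mem pH))
  qpE|//].
by rewrite qpE eqxx in qp.
Qed.

Lemma card_argmin p q : p \in H1 -> q \in H1 -> q != p ->
  0 < #|argmin_ratio p q| <= d.
Proof.
move=> pH qH qp; apply/andP; split.
  have [i0 _] : exists i : I, i \in predT by apply/card_gt0P; rewrite cardI.
  (* f i q * c i is q_i / p_i times the product of all coordinates of p *)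
  pose c i := \prod_(j | j != i) f j p.
  case: (arg_minnP (fun i => f i q * c i) (isT : xpredT i0)) => i _ min_i.
  apply/card_gt0P; exists i; apply/argmin_ratioP => j.
  have cE x : f x p * c x = \prod_y f y p by rewrite [RHS](bigD1 x).
  have P0 : 0 < \prod_y f y p.
    by apply: prodn_gt0 => x; exact: xg_clean xgG _ _ pH.
  rewrite -(leq_pmul2r P0) -{1}(cE i) -(cE j).
  have := leq_mul (leqnn (f i p * f j p)) (min_i j isT); lia.
rewrite -ltnS -cardI ltn_neqAle max_card andbT; apply/negP => /eqP allI.
have : \sum_i (f i q).+1 <= \sum_i f i p.
  apply: leq_sum => i _; apply: argmin_lt => //.
  suff -> : argmin_ratio p q = [set: I]%SET by rewrite inE.
  by apply/eqP; rewrite eqEcard finset.subsetT cardsT allI leqnn.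
under eq_bigr do rewrite -addn1.
by rewrite big_split /= !height1_sum // sum1_card cardI; lia.
Qed.

(** The cone of index i at p. Let e be the element with coordinate 1 at i; it
    generates G. Eliminating the vertex i by means of p, the coordinate of e at
    p is 1 / p_i and that at the vertex j is (e_j - p_j / p_i) / N = w_j / p_i,
    where w_j = [cut_weight j] is an integer because p = p_i e modulo N. So the
    group of the cone is Z/p_i with coordinates s w_j modulo p_i, where the slot
    i now belongs to p. The modulus is written as a successor to make 'I_t a
    group. *)
Section Cut.
Variables (p e : M) (i : I).
Hypotheses (pH : p \in H1) (eG : e \in G) (fe1 : f i e = 1).

Local Notation t := (f i p).-1.+1.

Definition cut_weight j := if j == i then 1 else (f i p * f j e) %/ N.
Definition cut_coord (j : I) (s : 'I_t) := (s * cut_weight j) %% t.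

Lemma cut_t : t = f i p.
Proof. by rewrite prednK // (xg_clean xgG). Qed.

Lemma cut_lt : f i p < N. Proof. exact: (rg_lt rgG). Qed.

Lemma cut_mem q : q \in G -> q = (e *+ f i q)%R.
Proof.
move=> qG; apply: (@coord_inj i) => //; first exact: (rg_mul rgG).
by rewrite (rg_mulE rgG) fe1 muln1 modn_small // (rg_lt rgG).
Qed.

Lemma cut_weightE j : j != i -> f i p * f j e = cut_weight j * N + f j p.
Proof.
move=> ji; rewrite {2}(cut_mem (height1_mem pH)) (rg_mulE rgG) /cut_weight
  (negPf ji).
exact: divn_eq.
Qed.

Lemma sum_coordD1 q : q \in H1 -> \sum_(j | j != i) f j q + f i q = N.
Proof.
by move=> qH; rewrite -[RHS](height1_sum qH) [RHS](bigD1 i) //= addnC. Qed.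

Lemma sum_cut_weight : \sum_j cut_weight j = t.
Proof.
rewrite cut_t (bigD1 i) //= {1}/cut_weight eqxx.
have eH := coord1_height1 eG fe1.
have sume := sum_coordD1 eH; have sump := sum_coordD1 pH.
have : \sum_(j | j != i) f i p * f j e =
       \sum_(j | j != i) (cut_weight j * N + f j p).
  by apply: eq_bigr => j; exact: cut_weightE.
rewrite -big_distrr big_split -big_distrl /= => eq1.
apply/eqP; rewrite -(eqn_pmul2r (rg_gt0 rgG)); apply/eqP.
move: eq1 sume sump; rewrite fe1.
move: (\sum_(j | _) f j e) (\sum_(j | _) f j p) (\sum_(j | _) cut_weight j).
move=> x y z E Ex Ey.
have : f i p * (x + 1) = z * N + N by rewrite mulnDr muln1 E -addnA Ey.
by rewrite Ex mulnDl mul1n addnC => ->.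
Qed.

Lemma cut_rg : residue_group t [set: 'I_t]%SET cut_coord.
Proof.
split=> [||a b _ _|a _|j a|j a b|a _|a _ fa0]; rewrite ?finset.in_setT //.
- exact: ltn_pmod.
- by rewrite /cut_coord /= modnMml modnDm mulnDl.
- rewrite /dvdn (eq_bigr (fun j => (a * cut_weight j) %% t)) // modn_summ.
  by rewrite -big_distrr /= sum_cut_weight modnMl.
apply: val_inj => /=; have := fa0 i.
by rewrite /cut_coord /cut_weight eqxx muln1 modn_small.
Qed.

Lemma cut_coordi s : cut_coord i s = s.
Proof. by rewrite /cut_coord /cut_weight eqxx muln1 modn_small. Qed.

(** The coordinates in the cone of a point q of that cone are nonnegative and
    less than 1, so reduction modulo p_i returns them exactly. *)
Lemma cut_of_argmin q (s : 'I_t) : q \in G -> i \in argmin_ratio p q ->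
    s = f i q :> nat ->
  forall j, j != i -> N * cut_coord j s + s * f j p = f i p * f j q.
Proof.
move=> qG /argmin_ratioP le sE j ji.
have {le} := le j; rewrite -sE => le.
have wE := cut_weightE ji.
have qE : f j q = (s * f j e) %% N by rewrite {1}(cut_mem qG) (rg_mulE rgG) -sE.
have dE := divn_eq (s * f j e) N; rewrite -qE in dE.
have fqN := rg_lt rgG j q; have N0 := rg_gt0 rgG.
rewrite /cut_coord; move: (cut_weight j) wE dE => w; move: (_ %/ _) => F wE dE.
have t0 : 0 < f i p by rewrite (xg_clean xgG).
have key : f i p * f j q + N * (f i p * F) = N * (s * w) + s * f j p.
  by nia.
have le1 : f i p * F <= s * w.
  by rewrite -(leq_pmul2l N0); nia.
have lt1 : s * w - f i p * F < f i p.
  rewrite -(ltn_pmul2l N0) mulnBr; nia.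
have -> : s * w = f i p * F + (s * w - f i p * F) by rewrite subnKC.
rewrite [f i p * F]mulnC -[X in (F * X + _) %% _]cut_t modnMDl.
rewrite [F * _]mulnC modn_small; last first.
  by move: lt1; rewrite -[X in _ < X -> _]cut_t.
by rewrite mulnBr; nia.
Qed.

Local Notation cut_H1 := (height1 t [set: 'I_t]%SET cut_coord).

Lemma cut_height1_of q (s : 'I_t) : q \in H1 -> i \in argmin_ratio p q ->
  s = f i q :> nat -> s \in cut_H1.
Proof.
move=> qH iq sE; apply/(height1P cut_rg); split; first by rewrite inE.
have := sum_coordD1 qH; have := sum_coordD1 pH.
have : \sum_(j | j != i) (N * cut_coord j s + s * f j p) =
       \sum_(j | j != i) f i p * f j q.
  by apply: eq_bigr => j; exact: (cut_of_argmin (height1_mem qH) iq sE).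
rewrite big_split -!big_distrr /= => eq1 sump sumq.
rewrite (bigD1 i) //= cut_coordi.
rewrite [RHS]cut_t; move: eq1; rewrite -sE in sumq *.
move: (\sum_(j | _) f j q) sumq => x Ex.
move: (\sum_(j | _) f j p) sump => y Ey.
move: (\sum_(j | _) cut_coord j s) => z E.
apply/eqP; rewrite -(eqn_pmul2r (rg_gt0 rgG)); apply/eqP.
nia.
Qed.

(** The element is q = s e. Its coordinate at j <> i is y_j below, in which the
    share s p_j / p_i of p is added to what the cone coordinate prescribes; the
    total being N, the y_j are less than N and no reduction occurs. *)
Lemma cut_height1_lift (s : 'I_t) : s \in cut_H1 ->
  exists q, [/\ q \in H1, q != p, i \in argmin_ratio p q, f i q = s &
    forall j, j != i -> N * cut_coord j s + s * f j p = f i p * f j q].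
Proof.
move=> /(height1P cut_rg)[_]; rewrite (bigD1 i) //= cut_coordi => sums.
have sump := sum_coordD1 pH; have N0 := rg_gt0 rgG; have tN := cut_lt.
have st : s < f i p by rewrite -[X in _ < X]cut_t.
pose q := (e *+ s)%R.
have qG : q \in G by exact: (rg_mul rgG).
have fiq : f i q = s.
  by rewrite (rg_mulE rgG) fe1 muln1 modn_small // (ltn_trans st).
pose y j := s * f j e - N * ((s * cut_weight j) %/ t).
have key j : j != i -> N * cut_coord j s + s * f j p +
    f i p * (N * ((s * cut_weight j) %/ t)) = f i p * (s * f j e).
  move=> ji; have wE := cut_weightE ji.
  have := divn_eq (s * cut_weight j) t; rewrite -/(cut_coord j s).
  rewrite [X in _ * X + _]cut_t.
  move: wE; set F := _ %/ _;
    move: F (cut_coord j s) (cut_weight j) => F c w wE dE.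
  nia.
have t0 : 0 < f i p by rewrite (xg_clean xgG).
have yle j : j != i -> N * ((s * cut_weight j) %/ t) <= s * f j e.
  by move=> ji; rewrite -(leq_pmul2l t0) -key // leq_addl.
have yE j : j != i -> N * cut_coord j s + s * f j p = f i p * y j.
  by move=> ji; rewrite mulnBr -key // addnK.
have sumy : \sum_(j | j != i) f i p * y j = f i p * (N - s).
  under eq_bigr do rewrite -yE //.
  rewrite big_split -!big_distrr /=.
  rewrite [RHS]cut_t in sums.
  move: (\sum_(j | _) cut_coord j s) sums => z Ez.
  move: (\sum_(j | _) f j p) sump => x Ex.
  by rewrite mulnBr; nia.
have s0 : 0 < s.
  rewrite lt0n; apply/eqP => s0; move: sums; rewrite big1 ?s0 // => j _.
  by rewrite /cut_coord s0 mod0n.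
have yN j : j != i -> y j < N.
  move=> ji; have := sumy; rewrite (bigD1 j) //=.
  have := leq0n (\sum_(j0 | (j0 != i) && (j0 != j)) f i p * y j0).
  move: (\sum_(_ | _) _) => z _ E.
  have : f i p * y j < f i p * N by nia.
  by rewrite ltn_pmul2l // (xg_clean xgG).
have fjq j : j != i -> f j q = y j.
  move=> ji; rewrite (rg_mulE rgG); have le := yle _ ji.
  by rewrite -(subnKC le) -/(y j) [N * _]mulnC modnMDl modn_small ?yN.
have sumq : \sum_(j | j != i) f j q = N - s.
  move: sumy; rewrite -big_distrr /= => /eqP; rewrite eqn_pmul2l; last first.
    exact: (xg_clean xgG).
  by move=> /eqP <-; apply: eq_bigr.
exists q; split=> //.
- by apply/(height1P rgG); split=> //; rewrite (bigD1 i) //= fiq sumq; lia.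
- by apply/eqP => qp; have := st; rewrite -fiq qp ltnn.
- apply/argmin_ratioP => j; rewrite fiq; have [->|ji] := eqVneq j i.
    by rewrite fiq.
  by rewrite fjq // [X in _ <= X]mulnC -yE // leq_addl.
by move=> j ji; rewrite fjq // yE.
Qed.

Local Notation cone := [set q in H1 | (q != p) && (i \in argmin_ratio p q)]%SET.

(** In the cone of i, the coordinate of q at j <> i vanishes exactly when the
    ratio q_j / p_j is minimal too, while the coordinate at i is positive. *)
Lemma cut_height_opp q (s : 'I_t) : q \in H1 -> i \in argmin_ratio p q ->
    s = f i q :> nat ->
  height t cut_coord (- s)%R = d.+1 - #|argmin_ratio p q|.
Proof.
move=> qH iq sE; have sH := cut_height1_of qH iq sE.
have := height_opp cut_rg (finset.in_setT s).
move: sH; rewrite inE => /andP[_ /eqP ->].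
have -> : [set j | cut_coord j s != 0]%SET = (~: (argmin_ratio p q :\ i))%SET.
  apply/setP => j; rewrite !inE; have [->|ji] /= := eqVneq j i.
    by rewrite cut_coordi sE -lt0n (xg_clean xgG).
  have := cut_of_argmin (height1_mem qH) iq sE ji; have N0 := rg_gt0 rgG.
  rewrite sE => E; congr (~~ _); apply/eqP/forallP => [c0 l|le].
    have leil := argmin_ratioP _ _ _ iq l; rewrite c0 muln0 add0n in E.
    have p0 : 0 < f i p by apply: xg_clean xgG _ _ pH.
    rewrite -(leq_pmul2l p0) mulnA -E.
    by have := leq_mul (leqnn (f j p)) leil; lia.
  by have := le i; rewrite mulnC -E; nia.
have := cardsC (argmin_ratio p q :\ i)%SET.
have arith a b c : a + b = d.+1 -> 1 + c = b -> c = d.+1 - (1 + a) by lia.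
by rewrite cardI (cardsD1 i (argmin_ratio p q)) iq /=; exact: arith.
Qed.

Definition cut_index (q : M) : 'I_t := inord (f i q).

Lemma cut_indexE q : q \in cone -> cut_index q = f i q :> nat.
Proof.
rewrite inE => /and3P[qH qp iq]; rewrite inordK //.
by rewrite [X in _ < X]cut_t; exact: argmin_lt.
Qed.

Lemma cut_index_inj : {in cone &, injective cut_index}.
Proof.
move=> q r qC rC /(congr1 val) /=; rewrite !cut_indexE // => /coord_inj; apply.
  by move: qC; rewrite inE => /and3P[/height1_mem].
by move: rC; rewrite inE => /and3P[/height1_mem].
Qed.

Lemma cut_index_sub : [set cut_index q | q in cone]%SET \subset cut_H1.
Proof.
apply/fintype.subsetP => s /imsetP[q qC ->]; have gq := cut_indexE qC.
by move: qC; rewrite inE => /and3P[qH _ iq]; exact: (@cut_height1_of q).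
Qed.

(** The bound of [card_residue_group] for the group of the cone, keeping only
    the terms that come from points of the cone. *)
Lemma cut_le :
  (\sum_(q in cone) (d.+1 - #|argmin_ratio p q|)).+1 <= f i p.
Proof.
have := card_residue_group cut_rg; rewrite cardsT card_ord.
rewrite [X in _ <= X]cut_t; apply: leq_trans; rewrite add1n ltnS.
pose g := cut_index; have gE := cut_indexE; have ginj := cut_index_inj.
rewrite (eq_bigr (fun q => height t cut_coord (- (g q))%R)); last first.
  move=> q qC; have gq := gE _ qC; move: qC; rewrite inE => /and3P[qH _ iq].
  by rewrite (@cut_height_opp q).
rewrite -(big_imset (fun s => height t cut_coord (- s)%R)) //=.
have sub := cut_index_sub.
rewrite [X in _ <= X](big_setID [set g q | q in cone]%SET) /=.
by rewrite (finset.setIidPr sub) leq_addr.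
Qed.

End Cut.

Lemma cone_le p i : p \in H1 ->
  (\sum_(q in H1 | (q != p) && (i \in argmin_ratio p q))
     (d.+1 - #|argmin_ratio p q|)).+1 <= f i p.
Proof.
move=> pH; have p1 : 1 < N.
  by apply: leq_ltn_trans (rg_lt rgG i p); exact: (xg_clean xgG).
have [e eG fe] := coord_surj i p1.
apply: leq_trans (cut_le pH eG fe); rewrite ltnS.
by rewrite big_mkcond [X in _ <= X]big_mkcond; apply: leq_sum => q _;
  rewrite inE.
Qed.

Lemma leq_mul_compl m : 0 < m <= d -> d <= m * (d.+1 - m).
Proof. by nia. Qed.

Lemma eq_mul_compl m : 0 < m <= d -> m * (d.+1 - m) = d -> m = 1 \/ m = d.
Proof. by nia. Qed.

Lemma sum_cone p :
  \sum_i (\sum_(q in H1 | (q != p) && (i \in argmin_ratio p q))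
     (d.+1 - #|argmin_ratio p q|)).+1 =
  d.+1 + \sum_(q in H1 | q != p)
     #|argmin_ratio p q| * (d.+1 - #|argmin_ratio p q|).
Proof.
under eq_bigr do rewrite -add1n.
rewrite big_split /= sum1_card cardI; congr (_ + _).
rewrite (exchange_big_dep (fun q => (q \in H1) && (q != p))) /=; last first.
  by move=> i q _ /and3P[-> ->].
apply: eq_bigr => q /andP[qH qp]; rewrite -sum_nat_const.
by apply: eq_bigl => i; rewrite qH qp.
Qed.

Lemma card_height1D p : p \in H1 -> #|H1| = (\sum_(q in H1 | q != p) 1).+1.
Proof. by move=> pH; rewrite -sum1_card (bigD1 p) //= add1n. Qed.

(** Summing [cone_le] over i and using [leq_mul_compl], N >= d + 1 + (the sum of
    m (d + 1 - m)) >= d + 1 + d (#|H1| - 1) = N, so all these inequalities are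
    equalities. *)
Lemma cone_extremal p : p \in H1 ->
  (forall i, f i p = (\sum_(q in H1 | (q != p) && (i \in argmin_ratio p q))
     (d.+1 - #|argmin_ratio p q|)).+1) /\
  (forall q, q \in H1 -> q != p ->
     #|argmin_ratio p q| * (d.+1 - #|argmin_ratio p q|) = d).
Proof.
move=> pH; have := height1_sum pH; have Nmin := card_extremal.
pose c i := (\sum_(q in H1 | (q != p) && (i \in argmin_ratio p q))
     (d.+1 - #|argmin_ratio p q|)).+1.
pose w q := #|argmin_ratio p q| * (d.+1 - #|argmin_ratio p q|).
have sumc : \sum_i c i = d.+1 + \sum_(q in H1 | q != p) w q by exact: sum_cone.
have wd q : (q \in H1) && (q != p) -> d <= w q.
  by move=> /andP[qH qp]; apply: leq_mul_compl; exact: card_argmin.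
have sumw : \sum_(q in H1 | q != p) d <= \sum_(q in H1 | q != p) w q.
  exact: leq_sum.
have sumcf : \sum_i c i <= \sum_i f i p.
  by apply: leq_sum => i _; exact: cone_le.
have kE := card_height1D pH.
have sumd : \sum_(q in H1 | q != p) d = d * (\sum_(q in H1 | q != p) 1).
  by rewrite big_distrr /=; apply: eq_bigr => *; rewrite muln1.
move=> sumf; rewrite kE mulnS in Nmin; split=> [i|q qH qp].
  apply/eqP; rewrite eqn_leq cone_le // andbT.
  have ge : \sum_(j | j != i) c j <= \sum_(j | j != i) f j p.
    by apply: leq_sum => j _; exact: cone_le.
  have sfE : \sum_j f j p = f i p + \sum_(j | j != i) f j p by exact: bigD1.
  have scE : \sum_j c j = c i + \sum_(j | j != i) c j by exact: bigD1.
  rewrite -/(c i); lia.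
apply/eqP; rewrite eqn_leq wd ?qH // andbT -/(w q).
have ge : \sum_(r in H1 | (r != p) && (r != q)) d <=
          \sum_(r in H1 | (r != p) && (r != q)) w r.
  by apply: leq_sum => r /and3P[rH rp _]; apply: wd; rewrite rH.
have splitq F : \sum_(r in H1 | r != p) F r =
    F q + \sum_(r in H1 | (r != p) && (r != q)) F r.
  by rewrite (bigD1 q) ?qH //=; congr (_ + _); apply: eq_bigl => r;
    rewrite -andbA.
have := splitq w; have := splitq (fun=> d); lia.
Qed.

Lemma argmin_card p q : p \in H1 -> q \in H1 -> q != p ->
  #|argmin_ratio p q| = 1 \/ #|argmin_ratio p q| = d.
Proof.
move=> pH qH qp; apply: eq_mul_compl; first exact: card_argmin.
by have [_ ->] := cone_extremal pH.
Qed.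

(** If no point of the cone of i other than p lies in a second cone, these
    points are interior to it, and [cone_extremal] computes its volume. *)
Lemma cut_extremal p e i : 0 < d -> p \in H1 -> e \in G -> f i e = 1 ->
    (forall q, q \in H1 -> q != p -> i \in argmin_ratio p q ->
       #|argmin_ratio p q| = 1) ->
  extremal_residue_group (f i p).-1.+1 [set: 'I_(f i p).-1.+1]%SET
    (@cut_coord p e i) /\
  #|height1 (f i p).-1.+1 [set: 'I_(f i p).-1.+1]%SET (@cut_coord p e i)| =
  #|[set q in H1 | (q != p) && (i \in argmin_ratio p q)]%SET|.
Proof.
move=> d0 pH eG fe1 single; set t := _.-1.+1; set C := [set q in H1 | _]%SET.
set K := height1 _ _ _; have rgT := cut_rg pH eG fe1.
have hopp s : s \in K -> height t (@cut_coord p e i) (- s)%R = d.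
  move=> /(cut_height1_lift pH eG fe1)[q [qH qp iq qs _]].
  by rewrite (cut_height_opp pH eG fe1 qH iq) // single // subn1.
have tE : t = (d * #|C|).+1.
  rewrite /t (cut_t i pH); have [-> _] := cone_extremal pH; congr _.+1.
  rewrite mulnC -sum_nat_const.
  rewrite [RHS](eq_bigl [pred q |
      (q \in H1) && ((q != p) && (i \in argmin_ratio p q))]).
    by apply: eq_bigr => q /and3P[qH qp iq]; rewrite single // subn1.
  by move=> q; rewrite !inE.
have KC : #|K| = #|C|.
  apply/eqP; rewrite eqn_leq -(leq_pmul2l d0) -ltnS -tE; apply/andP; split.
    have := card_residue_group rgT; rewrite cardsT card_ord.
    by rewrite (eq_bigr (fun=> d)) // sum_nat_const mulnC.
  rewrite -(card_in_imset (cut_index_inj pH)).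
  exact: subset_leq_card (cut_index_sub pH eG fe1).
split=> //; split=> //.
- move=> s j sK; rewrite lt0n; have := height_opp rgT (finset.in_setT s).
  rewrite hopp //; have := sK; rewrite inE => /andP[_ /eqP ->].
  rewrite add1n -cardI => E.
  have /eqP/setP/(_ j) : [set j | cut_coord e j s != 0]%SET == [set: I]%SET.
    by rewrite eqEcard finset.subsetT cardsT -E leqnn.
  by rewrite !inE.
- by rewrite cardsT card_ord.
by rewrite cardI KC.
Qed.
End Extremal.

(** * The standard point of an extremal group *)

Lemma modn_eq m c N r : m = c * N + r -> r < N -> m %% N = r.
Proof. by move=> -> rN; rewrite modnMDl modn_small. Qed.

(** In S_d(k) such an element is the lattice point (1 - k) (e_1 + ... + e_d),
    which has coordinate 1/N at each e_i. *)
Definition has_standard_point (M : finZmodType) (I : finType) (G : {set M})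
    (f : I -> M -> nat) : Prop :=
  exists2 c, c \in G & exists j, forall i, i != j -> f i c = 1.

Section Structure.
Variables (M : finZmodType) (I : finType) (N : nat) (d : nat).
Variables (G : {set M}) (f : I -> M -> nat).
Hypothesis xgG : extremal_residue_group N G f.
Hypothesis cardI : #|I| = d.+1.
Hypothesis d3 : 3 <= d.

Let rgG := xg_residue_group xgG.
Local Notation H1 := (height1 N G f).
Local Notation argmin_ratio := (argmin_ratio f).

Lemma card_setC2 (i j : I) : i != j -> #|(~: [set i; j])%SET| = d.-1.
Proof.
by move=> ij; have := cardsC [set i; j]%SET; rewrite cardI cards2 ij; lia. Qed.

(** This is where d >= 3 matters: d - 1 is neither 1 nor d. *)
Lemma argmin_not_setC2 p q i j : p \in H1 -> q \in H1 -> q != p -> i != j ->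
  argmin_ratio p q = (~: [set i; j])%SET -> False.
Proof.
move=> pH qH qp ij E; have := argmin_card xgG cardI pH qH qp.
by rewrite E card_setC2 //; lia.
Qed.

Lemma coord_pos i a : a \in H1 -> 0 < f i a.
Proof. exact: xg_clean xgG a i. Qed.

Lemma multiple_height1 a m : a \in G -> \sum_i (m * f i a) %% N = N ->
  (a *+ m)%R \in H1.
Proof.
move=> aG sumN; apply/(height1P rgG); split; first exact: (rg_mul rgG).
by rewrite -[RHS]sumN; apply: eq_bigr => i _; rewrite (rg_mulE rgG).
Qed.

Lemma sum_two_slots (i j : I) (F : I -> nat) x : i != j ->
    (forall l, l != i -> l != j -> F l = x) ->
  \sum_l F l = F i + F j + d.-1 * x.
Proof.
move=> ij Fx; rewrite (bigD1 i) //= (bigD1 j) 1?eq_sym //= addnA; congr (_ + _).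
rewrite (eq_bigr (fun=> x)); last by move=> l /andP[]; exact: Fx.
rewrite sum_nat_const -(card_setC2 ij); congr (_ * _).
by apply: eq_card => l; rewrite !inE negb_or.
Qed.

(** Source of all contradictions below: the ratio of a to p cannot be constant
    except for larger values at exactly two indices. *)
Lemma argmin_two_exceptions p a i j x : p \in H1 -> a \in H1 -> a != p ->
    i != j ->
  (forall l, l != i -> l != j -> forall m, f l a * f m p <= f m a * f l p) ->
  x != i -> x != j ->
  f x a * f i p < f i a * f x p -> f x a * f j p < f j a * f x p -> False.
Proof.
move=> pH aH ap ij le xi xj lti ltj.
apply: (argmin_not_setC2 pH aH ap ij); apply/setP => l; rewrite !inE.
have [->|li] /= := eqVneq l i.
  by apply/negP => /forallP/(_ x); rewrite leqNgt lti.
have [->|lj] /= := eqVneq l j.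
  by apply/negP => /forallP/(_ x); rewrite leqNgt ltj.
by apply/forallP; exact: le.
Qed.

Lemma third_index (i j : I) : i != j -> exists2 x, x != i & x != j.
Proof.
move=> ij; have /card_gt0P[x] :
  0 < #|(~: [set i; j])%SET| by rewrite card_setC2 //; lia.
by rewrite !inE negb_or => /andP[xi xj]; exists x.
Qed.

Lemma rest_ones p i1 j : p \in H1 -> N = f i1 p + d -> j != i1 -> f j p = 1.
Proof.
move=> pH NE ji; have := sum_coordD1 xgG i1 pH; rewrite (bigD1 j) //= => sumE.
have le : \sum_(l | (l != i1) && (l != j)) 1 <=
          \sum_(l | (l != i1) && (l != j)) f l p.
  by apply: leq_sum => l _; exact: coord_pos.
have cj : \sum_(l | (l != i1) && (l != j)) 1 = d.-1.
  rewrite sum1_card -(card_setC2 ji).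
  by apply: eq_card => l; rewrite !inE negb_or andbC.
have := coord_pos j pH; move: le; rewrite cj; lia.
Qed.

Lemma two_slot_sum p i1 j0 x : p \in H1 -> i1 != j0 ->
    (forall j, j != i1 -> j != j0 -> f j p = x) ->
  f i1 p + f j0 p + d.-1 * x = N.
Proof.
by move=> pH ij px; rewrite -(height1_sum xgG pH) (sum_two_slots ij px). Qed.

(** The double of r would have height 1, with coordinate 2 at i1 and 4 away from
    i1 and j0; the ratio of p to it is minimal, equal to 1/4, away from i1 and
    j0 only. *)
Lemma no_unit_slots p r i1 j0 : p \in H1 -> i1 != j0 -> r \in H1 ->
    f i1 r = 1 ->
    (forall j, j != i1 -> j != j0 -> f j r = 2) ->
    (forall j, j != i1 -> j != j0 -> f j p = 1) ->
    2 * f i1 p = N + 1 -> (d.*2.+1 <= f i1 p) ->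
  False.
Proof.
move=> pH ij rH r1 r2 p1 pN big.
have sump := two_slot_sum pH ij p1.
have sumr : \sum_l f l r = N by exact: (height1_sum xgG rH).
rewrite (sum_two_slots ij r2) r1 in sumr.
have [x xi xj] := third_index ij.
have [z [zH z1 zj z0]] : exists z, [/\ z \in H1, f i1 z = 2,
    forall l, l != i1 -> l != j0 -> f l z = 4 & f j0 z = N + 2 - 4 * d].
  have v1 : (2 * f i1 r) %% N = 2 by rewrite r1 modn_small //; lia.
  have vj l : l != i1 -> l != j0 -> (2 * f l r) %% N = 4.
    by move=> li lj; rewrite r2 // modn_small //; clear v1; lia.
  have v0 : (2 * f j0 r) %% N = N + 2 - 4 * d.
    by apply: (@modn_eq _ 1); clear v1 vj; lia.
  exists (r *+ 2)%R; split; rewrite ?(rg_mulE rgG) //.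
    apply: multiple_height1; first exact: (height1_mem rH).
    by rewrite (sum_two_slots ij vj) v1 v0; clear v1 vj v0; lia.
  by move=> l li lj; rewrite (rg_mulE rgG) vj.
clear sumr r1 r2 rH; apply: (@argmin_two_exceptions z p i1 j0 x) => //.
- by apply/eqP => pz; move: z1; rewrite -pz; lia.
- move=> l li lj m; rewrite (p1 l li lj) (zj l li lj).
  have [->|mi] := eqVneq m i1; first by rewrite z1; lia.
  have [->|mj] := eqVneq m j0; first by rewrite z0; lia.
  by rewrite (zj m mi mj) (p1 m mi mj).
- by rewrite (p1 x xi xj) z1 (zj x xi xj); lia.
by rewrite (p1 x xi xj) z0 (zj x xi xj); lia.
Qed.

(** The multiple 2 d p would have height 1, and its ratio to p would be minimal
    away from i1 and j0 only. *)
Lemma no_unit_apex p i1 j0 x : p \in H1 -> i1 != j0 -> f j0 p = 1 ->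
    (forall j, j != i1 -> j != j0 -> f j p = x) ->
    2 * f i1 p = N + x -> d < x ->
  False.
Proof.
move=> pH ij y1 px pN dx.
have sump := two_slot_sum pH ij px; rewrite y1 in sump.
have dE : d = d.-1.+1 by lia.
have [z zi zj] := third_index ij.
have dxE : d * x = d.-1 * x + x by rewrite {1}dE mulSn addnC.
have tE : f i1 p = 1 + d * x by lia.
have NE : N + x = 2 + 2 * (d * x) by lia.
have xdx : 3 * x <= d * x by rewrite leq_mul2r d3 orbT.
have ddx : d <= d * x by rewrite leq_pmulr //; lia.
have [w [wH w1 wj w0]] : exists w, [/\ w \in H1, f i1 w = d * x,
    forall l, l != i1 -> l != j0 -> f l w = x - 2 & f j0 w = d.*2].
  have dN : d * N + d * x = 2 * d + 2 * (d * (d * x)).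
    by rewrite -mulnDr NE mulnDr mulnC (mulnCA d 2).
  have v1 : (d.*2 * f i1 p) %% N = d * x.
    apply: (@modn_eq _ d); last lia.
    by rewrite dN tE -muln2; lia.
  have vj l : l != i1 -> l != j0 -> (d.*2 * f l p) %% N = x - 2.
    move=> li lj; rewrite px //; apply: (@modn_eq _ 1); last by clear v1; lia.
    by rewrite -muln2 mulnAC muln2; clear v1; lia.
  have v0 : (d.*2 * f j0 p) %% N = d.*2.
    by rewrite y1 muln1 modn_small //; clear v1 vj; lia.
  exists (p *+ d.*2)%R; split; rewrite ?(rg_mulE rgG) //.
    apply: multiple_height1; first exact: (height1_mem pH).
    rewrite (sum_two_slots ij vj) v1 v0 mulnBr; clear v1 vj v0 dN.
    by move: dxE xdx ddx NE; move: (d * x) (d.-1 * x) => u u'; lia.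
  by move=> l li lj; rewrite (rg_mulE rgG) vj.
have lt1 : (x - 2) * (1 + d * x) < d * x * x.
  rewrite mulnDr muln1 mulnBl [d * x * x]mulnC.
  have x3 : 3 * (d * x) <= x * (d * x) by rewrite leq_mul2r; lia.
  by move: x3 xdx; move: (x * (d * x)) (d * x) => u' u; lia.
apply: (@argmin_two_exceptions p w i1 j0 z) => //.
- by apply/eqP => wp; move: w1; rewrite wp tE; lia.
- move=> l li lj m; rewrite (px l li lj) (wj l li lj).
  have [->|mi] := eqVneq m i1.
    by rewrite w1 tE ltnW.
  have [->|mj] := eqVneq m j0; first by rewrite w0 y1; lia.
  by rewrite (wj m mi mj) (px m mi mj).
- by rewrite (px z zi zj) w1 (wj z zi zj) tE.
by rewrite (px z zi zj) w0 (wj z zi zj) y1; lia.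
Qed.

(** Below, q = 2 p in the group and only the coordinate at i1 wraps around. *)
Section Doubling.
Variables (p q : M) (i1 : I).
Hypotheses (pH : p \in H1) (qH : q \in H1).
Hypothesis fi1 : f i1 q + N = 2 * f i1 p.
Hypothesis fj : forall j, j != i1 -> f j q = 2 * f j p.

Lemma double_neq : q != p.
Proof.
have /card_gt0P[j] : 0 < #|[set~ i1]%SET|.
  by have := cardsC1 i1; rewrite cardI; lia.
rewrite !inE => /fj; have := coord_pos j pH => p0.
by apply: contra_eqN => /eqP ->; lia.
Qed.

(** Otherwise r / p is minimal at all indices but one, say j. Since q / p equals
    2 at all indices except i1, where it is smaller, r / q is minimal at all
    indices but i1 and j, contrary to [argmin_two_exceptions]. *)
Lemma double_clean r : r \in H1 -> r != p -> i1 \in argmin_ratio p r ->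
  #|argmin_ratio p r| = 1.
Proof.
move=> rH rp ir; have [//|rd] := argmin_card xgG cardI pH rH rp.
have [j jr] : exists j, argmin_ratio p r = [set~ j]%SET.
  have /cards1P[j jE] : #|(~: argmin_ratio p r)%SET| == 1.
    by have := cardsC (argmin_ratio p r); rewrite cardI rd; lia.
  by exists j; rewrite -jE finset.setCK.
have ij : i1 != j by move: ir; rewrite jr !inE.
have [x xi xj] := third_index ij.
have lr l m : l != j -> f l r * f m p <= f m r * f l p.
  move=> lj; have /argmin_ratioP le : l \in argmin_ratio p r by rewrite jr !inE.
  exact: le.
have gtj : f x r * f j p < f j r * f x p.
  have : j \notin argmin_ratio p r by rewrite jr !inE eqxx.
  rewrite inE negb_forall => /existsP[m]; rewrite -ltnNge => lt.
  have := lr x m xj; have := coord_pos m pH => pm.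
  rewrite -(ltn_pmul2l pm); have := coord_pos j pH; have := coord_pos x pH.
  nia.
exfalso; apply: (@argmin_two_exceptions q r i1 j x) => //.
- apply/eqP => rq; have := lr x i1 xj; rewrite rq fj // mulnAC.
  rewrite leq_pmul2r ?coord_pos // -fi1; have := rg_gt0 rgG; lia.
- move=> l li lj m; rewrite (fj li); have q2 : f m q <= 2 * f m p.
    by have [->|/fj -> //] := eqVneq m i1; rewrite -fi1 leq_addr.
  apply: leq_trans (leq_mul (leqnn _) q2) _.
  by rewrite mulnCA [X in _ <= X]mulnCA leq_pmul2l // lr.
- rewrite (fj xi); have := lr i1 x ij; have := lr x i1 xj.
  have := coord_pos x rH; have := rg_gt0 rgG.
  nia.
by rewrite (fj xi) fj 1?eq_sym //; nia.
Qed.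

End Doubling.
End Structure.

Section Step.
Variables (M : finZmodType) (I : finType) (N : nat) (d : nat).
Variables (G : {set M}) (f : I -> M -> nat).
Hypothesis xgG : extremal_residue_group N G f.
Hypothesis cardI : #|I| = d.+1.
Hypothesis d3 : 3 <= d.

Let rgG := xg_residue_group xgG.
Local Notation H1 := (height1 N G f).
Local Notation argmin_ratio := (argmin_ratio f).

(** By [double_clean] the cone of i1 at p is extremal, and it contains fewer
    points, so by induction its group has an element s with coordinates 1 at all
    indices but one, say j0. Let r be the element of height 1 that has these
    coordinates in the cone.

    If j0 = i1, the slot of p in the cone, then N = f i1 p + d, which forces the
    other coordinates of p to be 1. Otherwise the coordinates of r away from i1
    and j0 are 2 and those of p are x = 2 (f i1 p) - N. If x = 1, then p is
    standard when the cone has one point, and [no_unit_slots] applies when it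
    has more. If x > 1, then j0 = i0 because f i0 p = 1, and the total of the
    coordinates of p shows that d divides x - 1; so x > d and [no_unit_apex]
    applies. *)
Lemma double_step p q i1 i0 (pH : p \in H1) (qH : q \in H1)
    (fi1 : f i1 q + N = 2 * f i1 p)
    (fj : forall j, j != i1 -> f j q = 2 * f j p) : i0 != i1 -> f i0 p = 1 ->
    (forall (M' : finZmodType) N' (G' : {set M'}) (f' : I -> M' -> nat),
       extremal_residue_group N' G' f' ->
       0 < #|height1 N' G' f'| < #|H1| -> has_standard_point G' f') ->
  has_standard_point G f.
Proof.
move=> i01 p1 IH.
have p0 : 0 < f i1 q by exact: (coord_pos xgG _ qH).
have pN := rg_lt rgG i1 p; have qN := rg_lt rgG i1 q.
have N1 : 1 < N by lia.
have Nmin := card_extremal xgG cardI.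
have [e eG fe1] := coord_surj xgG cardI i1 N1.
have [xgT cardK] := cut_extremal xgG cardI (ltnW (ltnW d3)) pH eG fe1
  (double_clean xgG cardI d3 pH qH fi1 fj).
set C := [set _ in H1 | _]%SET in cardK.
have qC : q \in C.
  rewrite inE qH (double_neq xgG cardI d3 pH qH fi1 fj);
    apply/argmin_ratioP => m.
  have [->//|mi] := eqVneq m i1.
  by rewrite (fj _ mi) [X in _ <= X]mulnAC leq_mul2r -fi1 leq_addr orbT.
have CH : C \subset H1 :\ p.
  by apply/fintype.subsetP => r; rewrite !inE => /and3P[-> ->].
have := subset_leq_card CH; have := cardsD1 p H1; rewrite pH => cardH cardC.
have Cpos : 0 < #|C| by apply/card_gt0P; exists q.
have [|s _ [j0 s1]] := IH _ _ _ _ xgT; first by rewrite cardK; lia.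
have tE := xg_min xgT; rewrite cardI cardK /= in tE.
have t1 : (f i1 p).-1.+1 = f i1 p by exact: (cut_t xgG i1 pH).
rewrite t1 in tE.
have rgT := xg_residue_group xgT.
have sumc : \sum_j cut_coord N e (i := i1) j s =
  cut_coord N e (i := i1) j0 s + d.
  rewrite (bigD1 j0) //=; congr (_ + _); rewrite (eq_bigr (fun=> 1)) //.
  rewrite sum1_card; have := cardsC1 j0; rewrite cardI /= => <-.
  by apply: eq_card => j; rewrite !inE.
have ct : cut_coord N e (i := i1) j0 s < (f i1 p).-1.+1 by exact: (rg_lt rgT).
have cE : cut_coord N e (i := i1) j0 s + d = (f i1 p).-1.+1.
  have := rg_sum rgT (finset.in_setT s); rewrite sumc => /dvdnP[m mE].
  have dt : d < (f i1 p).-1.+1.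
    by rewrite [X in _ < X]t1 [X in _ < X]tE ltnS leq_pmulr.
  have one t c m' : c < t -> d < t -> c + d = m' * t -> c + d = t.
    move=> {}ct {}dt {}mE; have m2 : m' < 2 by rewrite -(@ltn_pmul2r t) -?mE;
      lia.
    by case: m' m2 mE => [|[|//]] _; rewrite ?mul1n //; lia.
  exact: one ct dt mE.
have sH : s \in height1 (f i1 p).-1.+1 [set: 'I__]%SET
  (cut_coord N e (i := i1)).
  by apply/(height1P rgT); rewrite sumc finset.in_setT.
have [r [rH rp _ rs rE]] := cut_height1_lift xgG cardI pH eG fe1 sH.
rewrite t1 in cE ct; have N0 := rg_gt0 rgG.
have [j0i1|j0i1] := eqVneq j0 i1.
  (* j0 is the slot of p in the cone *)
  have sE : s = f i1 p - d :> nat.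
    have := cut_coordi N e s; have : cut_coord N e (i := i1) j0 s =
      cut_coord N e (i := i1) i1 s by rewrite j0i1.
    by clear -cE; lia.
  have := rE _ i01; rewrite s1 ?j0i1 // p1 sE muln1 muln1 => E.
  have NE : N = f i1 p + d.
    move: E; case: (f i0 r) => [|[|[|m]]]; rewrite ?mulnS ?muln0.
    - by clear -d3 pN cE p0 fi1; lia.
    - by clear -d3 pN cE p0 fi1; lia.
    - by clear -d3 pN cE p0 fi1; lia.
    by move: (f i1 p * m) => u; clear -d3 pN cE p0 fi1; lia.
  exists p; first exact: (height1_mem pH).
  by exists i1 => j ji; exact: (rest_ones xgG cardI d3 pH NE ji).
have sE : s = 1 :> nat.
  by have := cut_coordi N e s; rewrite s1 1?eq_sym.
have r1 : f i1 r = 1 by rewrite rs.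
pose x := 2 * f i1 p - N.
have rpE j : j != i1 -> j != j0 -> f j r = 2 /\ f j p = x.
  move=> ji jj0; have := rE _ ji; rewrite s1 // sE muln1 mul1n => E.
  have pj : f j p < f i1 p.
    have := height1_sum xgG pH; rewrite (bigD1 i1) //= (bigD1 j) //=.
    by move: (\sum_(_ | _) _) => u; clear -fi1 p0; lia.
  have jr : f j r = 2.
    move: E; case: (f j r) => [|[|[|m]]]; rewrite ?mulnS ?muln0 //.
    - by clear -pN; lia.
    - by clear -pN; lia.
    by move: (f i1 p * m) => u; clear -pj pN p0 fi1; lia.
  by split=> //; move: E; rewrite jr /x; clear; lia.
have pNx : 2 * f i1 p = N + x by rewrite /x; clear -fi1; lia.
clear sumc ct cE rE rgT s1 sH sE.
have px j : j != i1 -> j != j0 -> f j p = x by move=> ji jj0;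
  case: (rpE j ji jj0).
rewrite eq_sym in j0i1.
have sump := two_slot_sum xgG cardI d3 pH j0i1 px.
have [x1|x1] := eqVneq x 1.
  have [k1|k1] := eqVneq #|C| 1.
    exists p; first exact: (height1_mem pH); exists i1 => j ji.
    have [->|jj0] := eqVneq j j0; last by rewrite px.
    by move: sump tE pNx; rewrite x1 k1; clear -d3; lia.
  exfalso; apply: (no_unit_slots xgG cardI d3 pH (r := r) (i1 := i1) (j0 := j0))
    => //.
  - by move=> j ji jj0; case: (rpE j ji jj0).
  - by move=> j ji jj0; rewrite px.
  - by rewrite pNx x1.
  by rewrite tE -muln2 ltnS leq_mul2l (ltn_neqAle 1) [1 == _]eq_sym k1 Cpos
    orbT.
have i0j0 : i0 = j0.
  by apply/eqP/negPn/negP => ij; move: x1; rewrite -(px _ i01 ij) p1.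
exfalso; apply: (no_unit_apex xgG cardI d3 pH (i1 := i1) (j0 := j0) (x := x)) =>
  //; first by rewrite -i0j0.
rewrite -i0j0 p1 in sump.
have [z zi zj] := third_index cardI d3 j0i1.
have x0 : 0 < x by rewrite -(px z zi zj) (coord_pos xgG).
have dE : d = d.-1.+1 by clear -d3; lia.
have dx : d * x = d.-1 * x + x by rewrite {1}dE mulSn addnC.
have : x - 1 = d * (2 * x - #|H1|).
  rewrite mulnBr mulnCA dx; move: Nmin sump pNx x0 dx.
  move: (d * #|H1|) (d.-1 * x) => u u'; clear; lia.
move: x0 x1; clear; case: (2 * x - #|H1|) => [|m]; first lia.
by rewrite mulnS; move: (d * m) => u; lia.
Qed.

(** Choose p with coordinate 1 at i0, and q with the second smallest coordinate
    s there. Elements below s at i0 are sums of copies of p without carries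
    ([run]), so each coordinate of q = s p wraps around at most once. Summing
    coordinates shows that s - 1 of them wrap. The ratio of p to q is minimal at
    the others, so s - 1 is d or 1 by [argmin_card]. *)
Lemma extremal_standard_step : 0 < #|H1| ->
    (forall (M' : finZmodType) N' (G' : {set M'}) (f' : I -> M' -> nat),
       extremal_residue_group N' G' f' ->
       0 < #|height1 N' G' f'| < #|H1| -> has_standard_point G' f') ->
  has_standard_point G f.
Proof.
move=> /card_gt0P[p0 p0H] IH.
have [i0 _] : exists i : I, i \in predT by apply/card_gt0P; rewrite cardI.
have N0 := rg_gt0 rgG; have Nmin := card_extremal xgG cardI.
have N1 : 1 < N.
  by apply: leq_ltn_trans (rg_lt rgG i0 p0); exact: (coord_pos xgG).
have [p pG p1] := coord_surj xgG cardI i0 N1.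
have pH : p \in H1 by exact: (coord1_height1 xgG cardI pG p1).
have sump := height1_sum xgG pH.
have [/existsP[q0 q0P]|alone] :=
    boolP [exists q, (q \in H1) && (q != p)]; last first.
  have H1E : H1 = [set p]%SET.
    apply/setP => q; rewrite finset.in_set1; apply/idP/eqP => [qH|-> //].
    apply/eqP; apply: contraNT alone => qp.
    by apply/existsP; exists q; rewrite qH.
  exists p => //; exists i0 => j ji; apply: (rest_ones xgG cardI d3 pH) ji.
  by move: Nmin; rewrite H1E cards1 p1; lia.
case: (arg_minnP (f i0) (q0P : [pred q | (q \in H1) && (q != p)] q0)).
move=> q /andP[qH qp] qmin {q0 q0P}.
have fq0 : 0 < f i0 q by exact: (coord_pos xgG).
have fq1 : f i0 q != 1.
  apply: contraNneq qp => fq1; apply/eqP.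
  apply: (coord_inj xgG cardI (i := i0)) pG _; first exact: (height1_mem qH).
  by rewrite fq1 p1.
(* below the second point the multiples of p do not wrap around *)
have run m x : x \in G -> f i0 x = m -> m < f i0 q ->
  forall j, f j x = m * f j p.
  elim: m x => [|m IHm] x xG xm mq j.
    rewrite (_ : x = 0%R) ?(rg_zeroE rgG) //.
    by apply: (coord_inj xgG cardI (i := i0) xG (rg_zero rgG));
      rewrite xm (rg_zeroE rgG).
  have x0 : x != 0%R by apply: contra_eqN xm => /eqP ->; rewrite (rg_zeroE rgG).
  have [a [b [aH bG xE fE]]] := height1_summand xgG cardI xG x0.
  have ap : a = p.
    apply/eqP/negPn/negP => ap; have /= := qmin a; rewrite aH ap => /(_ isT).
    by move: (fE i0) mq; rewrite xm; clear; lia.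
  have := fE i0; rewrite ap p1 xm add1n => -[bm].
  by rewrite fE ap (IHm b) ?mulSn // ltnW.
set s := f i0 q in fq0 fq1 run.
have sN : s < N by exact: (rg_lt rgG).
have xE := rg_mulE rgG i0 p s.-1.
rewrite p1 muln1 modn_small in xE; last lia.
have xG := rg_mul rgG s.-1 pG.
have runx := run _ _ xG xE.
have qE : q = (p *+ s.-1 + p)%R.
  apply: (coord_inj xgG cardI (i := i0) (height1_mem qH));
    first exact: (rg_add rgG).
  by rewrite (rg_addE rgG) xE p1 modn_small; rewrite -/s; lia.
have fqE j : f j q = s * f j p \/ f j q + N = s * f j p.
  have sE : s * f j p = s.-1 * f j p + f j p by rewrite -{1}(prednK fq0) mulSn
    addnC.
  rewrite sE -runx; last lia.
  by rewrite qE; case: (rg_addE_cases rgG j (p *+ s.-1)%R p) => [[]|];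
    [left|right].
pose C := [set j | f j q != s * f j p]%SET.
have cardC : #|C| = s.-1.
  have : \sum_j (f j q + (j \in C) * N) = \sum_j s * f j p.
    apply: eq_bigr => j _; rewrite inE; case: (fqE j) => [->|<-].
      by rewrite eqxx addn0.
    by rewrite -[X in X != _]addn0 eqn_add2l eq_sym -lt0n N0 mul1n.
  rewrite big_split -big_distrl -big_distrr /= sump (height1_sum xgG qH).
  rewrite -big_mkcond sum1_card -mulSn => /eqP.
  by rewrite eqn_pmul2r // => /eqP <-.
have argE : argmin_ratio q p = (~: C)%SET.
  apply/setP => j; rewrite !inE negbK; apply/idP/eqP => [/forallP/(_ i0)|fj].
    rewrite p1 mul1n -/s; case: (fqE j) => //; lia.
  by apply/forallP => l; rewrite fj; case: (fqE l); nia.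
have := argmin_card xgG cardI qH pH; rewrite argE eq_sym => /(_ qp).
have := cardsC C; rewrite cardC cardI => cardC' small.
have [sd|s2] : s = d.+1 \/ s = 2 by lia.
  (* all coordinates but i0 wrap in q, none in d p, so those of p are <= k *)
  have le_k j : j != i0 -> f j p <= #|H1|.
    move=> ji; have := rg_lt rgG j (p *+ s.-1)%R; rewrite runx ?sd /=; last lia.
    by rewrite [X in _ < X]Nmin ltnS leq_pmul2l //; lia.
  have eq_k j : j != i0 -> f j p = #|H1|.
    move=> ji; have := sum_coordD1 xgG i0 pH; rewrite p1 (bigD1 j) //= => sumE.
    have le : \sum_(l | (l != i0) && (l != j)) f l p <=
              \sum_(l | (l != i0) && (l != j)) #|H1|.
      by apply: leq_sum => l /andP[li _]; exact: le_k.
    have cj : \sum_(l | (l != i0) && (l != j)) #|H1| = d.-1 * #|H1|.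
      rewrite sum_nat_const -(card_setC2 cardI d3 ji); congr (_ * _).
      by apply: eq_card => l; rewrite !inE negb_or andbC.
    have dk : d * #|H1| = d.-1 * #|H1| + #|H1|.
      by rewrite -{1}(prednK (ltnW (ltnW d3))) mulSn addnC.
    move: le (le_k j ji) sumE Nmin; rewrite cj dk.
    have arith u u' a b m : u <= u' -> a <= b -> a + u + 1 = m ->
      m = (u' + b).+1 -> a = b by clear; lia.
    exact: arith.
  exists (- (p *+ s.-1))%R; first exact: (rg_opp rgG).
  exists i0 => j ji; rewrite (rg_oppE rgG) runx; last lia.
  rewrite eq_k // sd /=; have k0 : 0 < #|H1| by apply/card_gt0P; exists p.
  have := muln_gt0 d #|H1|; rewrite k0 (ltnW (ltnW d3)) => /= dk0.
  by rewrite -[X in if X then _ else _]negbK -lt0n dk0 /= {1}Nmin subSnn.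
have [i1 CE] : exists i1, C = [set i1]%SET.
  by apply/cards1P; rewrite cardC s2.
apply: (@double_step p q i1 i0 pH qH) => //.
- have : i1 \in C by rewrite CE set11.
  by rewrite inE; case: (fqE i1) => [->|->]; rewrite ?s2 ?eqxx.
- move=> j ji; have : j \notin C by rewrite CE inE.
  by rewrite inE negbK s2 => /eqP.
have : i0 \notin C by rewrite inE negbK p1 muln1.
by rewrite CE inE.
Qed.

End Step.

Theorem extremal_standard (M : finZmodType) (I : finType) (N d : nat)
    (G : {set M}) (f : I -> M -> nat) :
  extremal_residue_group N G f -> #|I| = d.+1 -> 3 <= d ->
  0 < #|height1 N G f| -> has_standard_point G f.
Proof.
move=> xgG cardI d3; have [n] := ubnP #|height1 N G f|.
elim: n => // n IHn in M N G f xgG * => ltn k0.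
apply: (extremal_standard_step xgG cardI d3 k0) =>
  M' N' G' f' xgG' /andP[k0' lt].
by apply: IHn xgG' _ k0'; lia.
Qed.

End ResidueGroups.

(** * Barycentric residues of a lattice simplex *)

Section Congruence.
Variables (n d : nat).
Local Notation N := n.+1.

Definition dvd_row m (y : 'rV[int]_m) : bool := [forall j, (N %| (y 0 j)%R)%Z].

Lemma dvd_rowP m (y : 'rV[int]_m) :
  reflect (forall j, (N %| (y 0 j)%R)%Z) (dvd_row y).
Proof. exact: forallP. Qed.

Lemma dvd_rowD m (y z : 'rV[int]_m) : dvd_row y -> dvd_row z -> dvd_row (y + z).
Proof.
by move=> /dvd_rowP yN /dvd_rowP zN; apply/dvd_rowP => j; rewrite mxE rpredD.
Qed.

Lemma dvd_rowN m (y : 'rV[int]_m) : dvd_row (- y) = dvd_row y.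
Proof. by apply: eq_forallb => j; rewrite mxE rpredN. Qed.

Lemma dvd_row_mulmx m p (y : 'rV[int]_m) (A : 'M[int]_(m, p)) :
  dvd_row y -> dvd_row (y *m A).
Proof.
move=> /dvd_rowP yN; apply/dvd_rowP => j; rewrite mxE; apply: rpred_sum => i _.
exact: dvdz_mulr.
Qed.

Definition zlift m (x : 'rV['I_N]_m) : 'rV[int]_m :=
  map_mx (fun a : 'I_N => (a : nat)%:Z) x.

Definition zred m (y : 'rV[int]_m) : 'rV['I_N]_m :=
  \row_j inord `|((y 0 j)%R %% N)%Z|%N.

Lemma zredK m (y : 'rV[int]_m) : dvd_row (zlift (zred y) - y).
Proof.
apply/dvd_rowP => j; rewrite !mxE.
have r0 : 0 <= ((y 0 j)%R %% N)%Z by apply: modz_ge0.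
have rN : ((y 0 j)%R %% N)%Z < N by apply: ltz_pmod.
rewrite inordK; last by lia.
by rewrite -eqz_mod_dvd gez0_abs // modz_mod.
Qed.

Lemma zlift_inj m (x y : 'rV['I_N]_m) : dvd_row (zlift x - zlift y) -> x = y.
Proof.
move=> /dvd_rowP xy; apply/rowP => j; apply/val_inj => /=.
have := xy j; rewrite !mxE -eqz_mod_dvd !modz_nat !modn_small //.
by move=> /eqP[].
Qed.

(** Such a are determined by the quotient a * m / N, which is less than m. *)
Lemma card_multiples m : (0 < m)%N ->
  (#|[pred a : 'I_N | N %| a * m]%N| <= m)%N.
Proof.
move=> m0; rewrite -[X in (_ <= X)%N]card_ord.
pose g (a : 'I_N) : 'I_m := insubd (Ordinal m0) ((a * m) %/ N)%N.
have gE (a : 'I_N) : g a = ((a * m) %/ N)%N :> nat.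
  rewrite val_insubd ifT // ltn_divLR // mulnC ltn_pmul2l //.
rewrite -(card_in_imset (f := g)); first exact: max_card.
move=> a b; rewrite !inE => aN bN /(congr1 val) /=; rewrite !gE => E.
apply/val_inj/eqP; rewrite -(eqn_pmul2r m0).
by rewrite -(divnK aN) -(divnK bN) E.
Qed.

Lemma absz_unit (x : int) : x \is a GRing.unit -> `|x|%N = 1%N.
Proof.
move=> xu; have := congr1 absz (mulrV xu); rewrite abszM absz1 => /eqP.
by rewrite muln_eq1 => /andP[/eqP].
Qed.

(** Write W = L D S by the Smith normal form. As L and S are invertible over the
    integers, x |-> x L is injective modulo N and turns the condition into one
    congruence for each diagonal entry of D; the product of these entries is the
    determinant up to sign. *)
Lemma card_kernel_mod (W : 'M[int]_d) : \det W != 0 ->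
  (#|[set x : 'rV['I_N]_d | dvd_row (zlift x *m W)]%SET| <= `|\det W|)%N.
Proof.
case: (int_Smith_normal_form W) => L Lu [S Su [s _ WE]] W0.
pose D : 'M[int]_d := diag_mx (\row_i s`_i).
have {}WE : W = L *m D *m S.
  by rewrite WE; congr (_ *m _ *m _); apply/matrixP => i j; rewrite !mxE.
have detW : `|\det W|%N = (\prod_(i < d) `|(s`_i)%R|)%N.
  have Lu1 : `|\det L|%N = 1%N by apply: absz_unit; rewrite -unitmxE.
  have Su1 : `|\det S|%N = 1%N by apply: absz_unit; rewrite -unitmxE.
  rewrite WE !det_mulmx !abszM Lu1 Su1 mul1n muln1 det_diag.
  elim/big_ind2: _ => // [x1 x2 y1 y2 <- <-|i _];
    [by rewrite abszM|by rewrite mxE].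
have s0 (i : 'I_d) : (0 < `|(s`_i)%R|)%N.
  rewrite absz_gt0; apply: contra_neq W0 => si0.
  rewrite WE !det_mulmx det_diag (bigD1 i) //= mxE si0.
  by rewrite !(mul0r, mulr0).
pose phi x := zred (zlift x *m L).
have phiE x : dvd_row (zlift (phi x) - zlift x *m L) by exact: zredK.
have phi_inj : injective phi.
  move=> x y xy; apply: zlift_inj.
  rewrite -[_ - _]mulmx1 -(mulmxV Lu) mulmxA; apply: dvd_row_mulmx.
  have -> : (zlift x - zlift y) *m L =
      - (zlift (phi x) - zlift x *m L) + (zlift (phi y) - zlift y *m L).
    by rewrite xy mulmxBl opprB addrA subrK.
  by apply: dvd_rowD; rewrite ?dvd_rowN.
pose F (i : 'I_d) := [pred a : 'I_N | N %| a * `|(s`_i)%R|]%N.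
pose psi x : {ffun 'I_d -> 'I_N} := [ffun i => phi x 0 i].
have psi_inj : injective psi.
  move=> x y /ffunP E; apply: phi_inj; apply/rowP => i.
  by have := E i; rewrite !ffunE.
rewrite -(card_imset _ psi_inj) detW.
apply: (@leq_trans #|family F|); last first.
  rewrite card_family foldrE big_map big_enum /=.
  by apply: leq_prod => i _; exact: card_multiples.
apply: subset_leq_card; apply/fintype.subsetP => z /imsetP[x];
  rewrite inE => xW -> {z}.
apply/familyP => i; rewrite ffunE !inE.
have : dvd_row (zlift (phi x) *m D).
  have -> : zlift (phi x) *m D =
    (zlift (phi x) - zlift x *m L) *m D + zlift x *m W *m invmx S.
    by rewrite WE !mulmxA mulmxK // mulmxBl subrK.
  by apply: dvd_rowD; exact: dvd_row_mulmx.
by move=> /dvd_rowP/(_ i); rewrite mul_mx_diag !mxE dvdzE abszM.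
Qed.

Variable V : 'I_d.+1 -> 'rV[int]_d.

(** The column of ones records the total of the coordinates, the other columns
    the point. *)
Definition homog_mx : 'M[int]_(d.+1, 1 + d) :=
  row_mx (const_mx 1) (\matrix_i V i).

Definition lattice_group : {set 'rV['I_N]_d.+1} :=
  [set c | dvd_row (zlift c *m homog_mx)]%SET.

Definition edge_int : 'M[int]_d := \matrix_i (V (lift ord0 i) - V ord0).

Lemma lattice_groupP (c : 'rV['I_N]_d.+1) : reflect
  ((N %| \sum_i (c ord0 i : nat))%N /\
   dvd_row (\sum_i (c ord0 i : nat)%:Z *: V i)) (c \in lattice_group).
Proof.
have sumE : zlift c *m homog_mx = row_mx
    (\sum_i (c ord0 i : nat))%:Z%:M (\sum_i (c ord0 i : nat)%:Z *: V i).
  rewrite mul_mx_row; congr row_mx.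
    apply/matrixP => i j; rewrite !mxE !ord1 eqxx mulr1n
      (big_morph Posz PoszD erefl).
    by apply: eq_bigr => l _; rewrite !mxE mulr1.
  rewrite mulmx_sum_row; apply: eq_bigr => i _; by rewrite rowK !mxE.
rewrite inE sumE; apply: (iffP (dvd_rowP _)) => [H|[sN /dvd_rowP VN] j].
  split; first by have := H (lshift d ord0); rewrite row_mxEl mxE.
  by apply/dvd_rowP => j; have := H (rshift 1 j); rewrite row_mxEr.
rewrite mxE; case: splitP => l _; last exact: VN.
by rewrite mxE !ord1 eqxx mulr1n dvdzE.
Qed.

Lemma zliftD m (x y : 'rV['I_N]_m) :
  dvd_row (zlift (x + y) - (zlift x + zlift y)).
Proof.
by apply/dvd_rowP => j; rewrite !mxE /= -eqz_mod_dvd -PoszD !modz_nat modn_mod.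
Qed.

Lemma lattice_group_rg :
  residue_group N lattice_group (fun i (c : 'rV['I_N]_d.+1) => c ord0 i : nat).
Proof.
have zl0 m : zlift (0 : 'rV['I_N]_m) = 0 by apply/rowP => j; rewrite !mxE.
have GD a b : a \in lattice_group -> b \in lattice_group ->
  a + b \in lattice_group.
  rewrite !inE => aG bG; rewrite -[zlift _](subrK (zlift a + zlift b)) mulmxDl.
  apply: dvd_rowD; first exact/dvd_row_mulmx/zliftD.
  by rewrite mulmxDl dvd_rowD.
have G0 : 0 \in lattice_group.
  by rewrite inE zl0 mul0mx; apply/dvd_rowP => j; rewrite mxE dvdz0.
split=> // [a aG|i a b|a /lattice_groupP[]//|a _ a0].
- rewrite inE -[zlift _](addrK (zlift a)) mulmxBl; apply: dvd_rowD; last first.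
    by rewrite dvd_rowN; move: aG; rewrite inE.
  apply: dvd_row_mulmx; rewrite -[X in dvd_row X]opprK dvd_rowN opprD.
  by have := zliftD (- a) a; rewrite addNr zl0 sub0r opprD.
- by rewrite mxE.
by apply/rowP => j; apply/val_inj; rewrite /= a0 mxE.
Qed.

(** The coordinate at the vertex 0 is determined by the others, and eliminating
    it leaves the kernel modulo N of the edge matrix. *)
Lemma card_lattice_group : \det edge_int != 0 ->
  (#|lattice_group| <= `|\det edge_int|)%N.
Proof.
move=> W0; apply: leq_trans (card_kernel_mod W0).
pose g (c : 'rV['I_N]_d.+1) : 'rV['I_N]_d := \row_j c ord0 (lift ord0 j).
rewrite -(card_in_imset (f := g)).
  apply: subset_leq_card; apply/fintype.subsetP => z /imsetP[c cG ->{z}];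
    rewrite inE.
  have /lattice_groupP[sN VN] := cG.
  have -> : zlift (g c) *m edge_int = \sum_i (c ord0 i : nat)%:Z *: V i -
      (\sum_i (c ord0 i : nat))%:Z *: V ord0.
    rewrite (big_morph Posz PoszD erefl) scaler_suml -sumrB big_ord_recl subrr
      add0r.
    rewrite mulmx_sum_row; apply: eq_bigr => i _.
    by rewrite rowK !mxE scalerBr.
  apply: dvd_rowD => //; rewrite dvd_rowN; apply/dvd_rowP => j.
  by rewrite mxE dvdz_mulr // dvdzE.
move=> a b aG bG /rowP E; have /lattice_groupP[aN _] := aG.
have /lattice_groupP[bN _] := bG.
have El j : a ord0 (lift ord0 j) = b ord0 (lift ord0 j) by have := E j;
  rewrite !mxE.
apply/rowP => i; have [j ->|->] := unliftP ord0 i; first exact: El.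
apply/val_inj => /=; move: aN bN; rewrite !big_ord_recl.
rewrite (eq_bigr (fun j => b ord0 (lift ord0 j) : nat)); last by move=> j _;
  rewrite El.
rewrite /dvdn => /eqP aN' /eqP bN'.
have /eqP := etrans aN' (esym bN').
by rewrite eqn_modDr !modn_small // => /eqP.
Qed.

End Congruence.

(** * Linear change of variables *)

Section LebesgueTuple.
Context {R : realType}.
Local Notation T := (measurableTypeR R).
Local Notation mu := (@lebesgue_measure R).

(** Both sides are measures in A, so it suffices to compare them on half-open
    intervals. For c < 0 the preimage of ]u, v] is open on the other side. *)
Lemma lebesgue_measure_affine (c b : R) (A : set T) : c != 0 -> measurable A ->
  (`|c|%:E * mu ((fun x => c * x + b)%R @^-1` A))%E = mu A.
Proof.
move=> c0 mA.
have mf : measurable_fun [set: T] (fun x : T => c * x + b : T).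
  by apply: measurable_funD => //; exact: measurable_funM.
have nc0 : 0 <= `|c| by [].
pose m' := mscale (NngNum nc0)
  (measure_function_pushforward__canonical__measure_function_Measure mu mf).
apply/esym; rewrite (@lebesgue_measure_unique _ m') // => _ [[u v]] _ <-.
transitivity (`|c|%:E * mu ((fun x => c * x + b)%R @^-1` `]u, v]%classic))%E =>
  //.
have [cp|cn|c00] := ltgtP 0 c; last by rewrite -c00 eqxx in c0.
  rewrite [in RHS](_ : _ @^-1` _ = `](u - b) / c, (v - b) / c]%classic);
    last first.
    apply/seteqP; split=> x /=; rewrite !in_itv /=.
      by rewrite ltr_pdivrMr // ler_pdivlMr // ltrBlDr lerBrDr mulrC.
    by rewrite ltr_pdivrMr // ler_pdivlMr // ltrBlDr lerBrDr mulrC.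
  rewrite !lebesgue_measure_itv /= !lte_fin ltr_pM2r ?invr_gt0 // ltrD2r.
  case: ifP => _; last by rewrite mule0.
  rewrite -!EFinB -EFinM; congr _%:E; rewrite gtr0_norm //; field.
  by rewrite gt_eqF.
rewrite [in RHS](_ : _ @^-1` _ =
  `[(v - b) / c, (u - b) / c[%classic); last first.
  apply/seteqP; split=> x /=; rewrite !in_itv /=.
    by rewrite ltr_ndivlMr // ler_ndivrMr // ltrBlDr lerBrDr mulrC andbC.
  by rewrite ltr_ndivlMr // ler_ndivrMr // ltrBlDr lerBrDr mulrC andbC.
rewrite !lebesgue_measure_itv /= !lte_fin ltr_nM2r ?invr_lt0 // ltrD2r.
case: ifP => _; last by rewrite mule0.
rewrite -!EFinB -EFinM; congr _%:E; rewrite ltr0_norm //; field.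
by rewrite lt_eqF.
Qed.

Definition cons_tuple n (p : T * n.-tuple T) : n.+1.-tuple T :=
  [tuple of p.1 :: p.2].

Lemma measurable_cons_tuple n : measurable_fun setT (@cons_tuple n).
Proof. exact: measurable_cons. Qed.

Lemma measurable_cons_preimage n (B : set (n.+1.-tuple T)) :
  measurable B -> measurable (@cons_tuple n @^-1` B).
Proof.
by move=> mB; rewrite -[X in measurable X]setTI; exact: measurable_cons_tuple.
Qed.

(** The first coordinate can be integrated last, as here, or first, as in the
    next lemma; each kind of shear below needs its own order. *)
Lemma lebesgue_tupleS1 n (B : set (n.+1.-tuple T)) :
  lebesgue_tuple n.+1 B =
  (\int[mu]_x lebesgue_tuple n [set t | B (cons_tuple (x, t))])%E.
Proof.
rewrite [LHS]/= /cons_measure /pushforward /product_measure1.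
apply: eq_integral => x _ /=; congr (lebesgue_tuple n _).
by apply/seteqP; split=> t; rewrite /xsection /= inE.
Qed.

Lemma lebesgue_tupleS2 n (B : set (n.+1.-tuple T)) : measurable B ->
  lebesgue_tuple n.+1 B =
  (\int[lebesgue_tuple n]_t mu [set x | B (cons_tuple (x, t))])%E.
Proof.
move=> mB.
transitivity ((mu \x^ lebesgue_tuple n)%E (@cons_tuple n @^-1` B)).
  rewrite [LHS]/= /cons_measure /pushforward.
  apply: product_measure_unique; last exact: measurable_cons_preimage.
  by move=> A1 A2 mA1 mA2 /=; rewrite product_measure2E.
rewrite /product_measure2; apply: eq_integral => t _ /=; congr (mu _).
by apply/seteqP; split=> x; rewrite /ysection /= inE.
Qed.

(** That f multiplies volumes by |c|, in terms of preimages, which are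
    measurable without any assumption on an inverse of f. *)
Definition scales n (f : n.-tuple T -> n.-tuple T) (c : R) : Prop :=
  measurable_fun [set: n.-tuple T] f /\
  forall B, measurable B ->
    (`|c|%:E * lebesgue_tuple n (f @^-1` B))%E = lebesgue_tuple n B.

Lemma scales_comp n (f g : n.-tuple T -> n.-tuple T) (a c : R) :
  scales f a -> scales g c -> scales (g \o f) (a * c).
Proof.
move=> [mf fE] [mg gE]; split; first exact: measurableT_comp.
move=> B mB; rewrite normrM EFinM comp_preimage muleAC fE.
  by rewrite muleC gE.
by rewrite -[X in measurable X]setTI; exact: mg.
Qed.

Definition tuple_of n (x : 'rV[R]_n) : n.-tuple T := [tuple x 0 i | i < n].
Definition row_of n (t : n.-tuple T) : 'rV[R]_n := \row_i tnth t i.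

Lemma row_ofK n : cancel (@row_of n) (@tuple_of n).
Proof. by move=> t; apply: eq_from_tnth => i; rewrite tnth_mktuple mxE. Qed.

Lemma tuple_ofK n : cancel (@tuple_of n) (@row_of n).
Proof. by move=> x; apply/rowP => i; rewrite mxE tnth_mktuple. Qed.

Definition affine n (M : 'M[R]_n) (b : 'rV[R]_n) (t : n.-tuple T) :=
  tuple_of (row_of t *m M + b).

Lemma measurable_coord n (i : 'I_n) (c : R) :
  measurable_fun [set: n.-tuple T] (fun t => tnth t i * c : T).
Proof. by apply: measurable_funM => //; exact: measurable_tnth. Qed.

Lemma measurable_affine n (M : 'M[R]_n) b : measurable_fun setT (affine M b).
Proof.
apply/measurable_fun_tnthP => i.
rewrite (_ : _ \o _ = fun t => \sum_j tnth t j * M j i + b 0 i); last first.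
  apply/funext => t /=; rewrite tnth_mktuple !mxE; congr (_ + _).
  by apply: eq_bigr => j _; rewrite mxE.
apply: measurable_funD => //; apply: measurable_sum => j.
exact: measurable_coord.
Qed.

Lemma affine_comp n (M M' : 'M[R]_n) b b' :
  affine M' b' \o affine M b = affine (M *m M') (b *m M' + b').
Proof.
by apply/funext => t; rewrite /affine /= tuple_ofK mulmxDl mulmxA addrA.
Qed.

Lemma row_of_cons n (x : R) (t : n.-tuple T) :
  row_of (cons_tuple (x, t)) = row_mx x%:M (row_of t) :> 'rV[R]_(1 + n).
Proof.
apply/rowP => i; rewrite 2!mxE; case: splitP => j ij.
  by rewrite ord1 mxE (tnth_nth x) ij ord1.
by rewrite mxE !(tnth_nth x) ij.
Qed.

Lemma tuple_of_row n (x : R) (u : 'rV[R]_n) :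
  tuple_of (row_mx x%:M u : 'rV[R]_(1 + n)) = cons_tuple (x, tuple_of u).
Proof.
apply: (can_inj (@row_ofK _)); rewrite tuple_ofK.
by rewrite (row_of_cons x (tuple_of u)) tuple_ofK.
Qed.

Lemma affine_block n (a : R) (r : 'rV[R]_n) (c : 'cV[R]_n) (M : 'M[R]_n) (b : R)
    (v : 'rV[R]_n) x t :
  affine (block_mx a%:M r c M : 'M[R]_(1 + n)) (row_mx b%:M v : 'rV[R]_(1 + n))
    (cons_tuple (x, t)) =
  cons_tuple (a * x + ((row_of t *m c) 0 0 + b), affine M (x *: r + v) t).
Proof.
rewrite /affine -tuple_of_row (row_of_cons x t).
rewrite (mul_row_block x%:M) add_row_mx; congr (tuple_of (row_mx _ _)).
  apply/matrixP => i j; rewrite !ord1 !mxE eqxx !mulr1n addrA.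
  by congr (_ + _ + _); rewrite big_ord1 !mxE mulr1n mulrC.
by rewrite mul_scalar_mx [RHS]addrCA addrA.
Qed.

Let integralZ d (X : measurableType d) (m : {measure set X -> \bar R}) (a : R)
    (f g : X -> \bar R) :
    measurable_fun setT f -> (forall x, (0 <= f x)%E) ->
    (forall x, (`|a|%:E * f x)%E = g x) ->
  (`|a|%:E * \int[m]_x f x)%E = (\int[m]_x g x)%E.
Proof.
move=> mf f0 fg; rewrite -ge0_integralZl ?lee_fin //.
by apply: eq_integral => x _.
Qed.

Lemma measurable_section1 n (B : set (n.+1.-tuple T)) : measurable B ->
  measurable_fun setT
    (fun x => lebesgue_tuple n [set t | B (cons_tuple (x, t))]).
Proof.
move=> mB.
have := measurable_fun_xsection (lebesgue_tuple n)
  (measurable_cons_preimage mB).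
apply: eq_measurable_fun => x _ /=; congr (lebesgue_tuple n _).
by apply/seteqP; split=> t; rewrite /xsection /= inE.
Qed.

Lemma measurable_section2 n (B : set (n.+1.-tuple T)) : measurable B ->
  measurable_fun setT (fun t => mu [set x | B (cons_tuple (x, t))]).
Proof.
move=> mB.
have := measurable_fun_ysection mu (measurable_cons_preimage mB).
apply: eq_measurable_fun => t _ /=; congr (mu _).
by apply/seteqP; split=> x; rewrite /ysection /= inE.
Qed.

Lemma measurable_slice1 n (B : set (n.+1.-tuple T)) x : measurable B ->
  measurable [set t | B (cons_tuple (x, t))].
Proof.
move=> mB; have := measurable_xsection x (measurable_cons_preimage mB).
by congr measurable; apply/seteqP; split=> t; rewrite /xsection /= inE.
Qed.

Lemma measurable_slice2 n (B : set (n.+1.-tuple T)) t : measurable B ->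
  measurable [set x | B (cons_tuple (x, t))].
Proof.
move=> mB; have := measurable_ysection t (measurable_cons_preimage mB).
by congr measurable; apply/seteqP; split=> x; rewrite /ysection /= inE.
Qed.

(** The map changes the first coordinate only, by an affine map of the line that
    depends on the other coordinates. *)
Lemma scales_shear_first n (a b : R) (c : 'cV[R]_n) : a != 0 ->
  scales (affine (block_mx a%:M 0 c 1%:M : 'M[R]_(1 + n))
            (row_mx b%:M 0 : 'rV[R]_(1 + n))) a.
Proof.
move=> a0; set f := affine _ _; have mf : measurable_fun setT f.
  exact: measurable_affine.
split=> // B mB; have mfB : measurable (f @^-1` B).
  by rewrite -[X in measurable X]setTI; exact: mf.
rewrite !lebesgue_tupleS2 //; apply: integralZ => [|t|t].
- exact: measurable_section2.
- exact: measure_ge0.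
rewrite -[RHS](@lebesgue_measure_affine a ((row_of t *m c) 0 0 + b)) //;
  last first.
  exact: measurable_slice2.
have fE x : f (cons_tuple (x, t)) =
    cons_tuple (a * x + ((row_of t *m c) 0 0 + b), t).
  rewrite /f affine_block /affine mulmx1 scaler0 !addr0 row_ofK //.
by congr (_ * mu _)%E; apply/seteqP; split=> x; rewrite /= fE.
Qed.

(** The map keeps the first coordinate, and acts on the others by an affine map
    of linear part M. *)
Lemma scales_shear_rest n (r b : 'rV[R]_n) (M : 'M[R]_n) (c : R) :
    (forall v, scales (affine M v) c) ->
  scales (affine (block_mx 1%:M r 0 M : 'M[R]_(1 + n))
            (row_mx 0%:M b : 'rV[R]_(1 + n))) c.
Proof.
move=> Mc; set f := affine _ _; have mf : measurable_fun setT f.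
  exact: measurable_affine.
split=> // B mB; have mfB : measurable (f @^-1` B).
  by rewrite -[X in measurable X]setTI; exact: mf.
rewrite !lebesgue_tupleS1; apply: integralZ => [|x|x].
- exact: measurable_section1.
- exact: measure_ge0.
have [_ ME] := Mc (x *: r + b); rewrite -[RHS]ME; last exact: measurable_slice1.
have fE t : f (cons_tuple (x, t)) = cons_tuple (x, affine M (x *: r + b) t).
  by rewrite /f affine_block mulmx0 mxE addr0 mul1r addr0.
by congr (_ * lebesgue_tuple _ _)%E; apply/seteqP; split=> t /=; rewrite fE.
Qed.

(** With a nonzero pivot, elimination factors the matrix into a shear, a map of
    the remaining coordinates and a dilation of the first one; N is the Schur
    complement of the pivot. *)
Lemma scales_pivot n (a : R) (r : 'rV[R]_n) (c : 'cV[R]_n) (M : 'M[R]_n) b :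
    (forall N : 'M[R]_n, N \in unitmx ->
       forall v, scales (affine N v) (\det N)) ->
    a != 0 -> (block_mx a%:M r c M : 'M[R]_(1 + n)) \in unitmx ->
  scales (affine (block_mx a%:M r c M : 'M[R]_(1 + n)) b)
    (\det (block_mx a%:M r c M)).
Proof.
move=> IH a0 Au; set A := block_mx _ _ _ _.
pose N := M - a^-1 *: (c *m r).
have AE : A = (block_mx 1%:M 0 (a^-1 *: c) 1%:M : 'M[R]_(1 + n)) *m
  ((block_mx 1%:M r 0 N : 'M[R]_(1 + n)) *m block_mx a%:M 0 0 1%:M).
  rewrite !mulmx_block !mul0mx !mulmx0 !mul1mx !mulmx1 !addr0 !add0r.
  rewrite mul_mx_scalar scalerA mulfV // scale1r -scalemxAl.
  by rewrite /N addrC subrK.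
have detA : \det A = \det N * a.
  rewrite AE !det_mulmx det_lblock !det_ublock !det1 !mul1r.
  by rewrite det_scalar1 mulr1.
have Nu : N \in unitmx.
  move: Au; rewrite !unitmxE -/A detA !unitfE mulf_eq0 negb_or.
  by case/andP.
pose b1 := (lsubmx (b : 'rV[R]_(1 + n))) 0 0;
  pose b2 := rsubmx (b : 'rV[R]_(1 + n)).
have bE : b = row_mx b1%:M b2.
  by rewrite -[LHS](hsubmxK (b : 'rV[R]_(1 + n))); congr row_mx;
    exact: mx11_scalar.
have -> : affine A b =
    affine (block_mx a%:M 0 0 1%:M : 'M[R]_(1 + n))
      (row_mx b1%:M 0 : 'rV[R]_(1 + n)) \o
    (affine (block_mx 1%:M r 0 N : 'M[R]_(1 + n))
       (row_mx 0%:M b2 : 'rV[R]_(1 + n)) \o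
     affine (block_mx 1%:M 0 (a^-1 *: c) 1%:M : 'M[R]_(1 + n))
       (row_mx 0%:M 0 : 'rV[R]_(1 + n))).
  rewrite !affine_comp -mulmxA -AE; congr affine.
  rewrite [LHS]bE !(raddf0, row_mx0) mul0mx add0r (mul_row_block 0 b2)
    add_row_mx.
  rewrite !mul0mx !mulmx0 mulmx1 add0r !addr0 ?add0r; congr row_mx.
rewrite detA -[\det N]mul1r; apply: scales_comp; last exact: scales_shear_first.
apply: scales_comp; first exact: scales_shear_first (oner_neq0 R).
by apply: scales_shear_rest => v; exact: IH.
Qed.

Lemma block_pivot n (M : 'M[R]_(1 + n)) :
  M = block_mx (M 0 0)%:M (ursubmx M) (dlsubmx M) (drsubmx M).
Proof.
rewrite -[LHS]submxK; congr block_mx.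
by rewrite [LHS]mx11_scalar; congr _%:M; rewrite !mxE; congr (M _ _);
  exact/val_inj.
Qed.

Lemma block_pivot00 n (A : 'M[R]_1) (r : 'rV[R]_n) (c : 'cV[R]_n) M :
  (block_mx A r c M : 'M[R]_(1 + n)) 0 0 = A 0 0.
Proof.
have -> : 0 = lshift n 0 :> 'I_(1 + n) by exact/val_inj.
exact: block_mxEul.
Qed.

(** If the pivot vanishes, another entry of the first row does not, and adding
    its column to the first one, which has determinant 1, produces a pivot. *)
Theorem scales_affine n (M : 'M[R]_n) b : M \in unitmx ->
  scales (affine M b) (\det M).
Proof.
elim: n M b => [|n IH] M b Mu.
  have -> : affine M b = id by apply/funext => t;
    rewrite [RHS]tuple0 [LHS]tuple0.
  by split=> // B _; rewrite det_mx00 normr1 mul1e preimage_id.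
have IHn (N : 'M[R]_n) : N \in unitmx -> forall v, scales (affine N v) (\det N).
  by move=> Nu v; exact: IH.
have corner (N : 'M[R]_(1 + n)) v : N 0 0 != 0 -> N \in unitmx ->
    scales (affine N v) (\det N).
  by move=> N0; rewrite (block_pivot N) => Nu; exact: scales_pivot.
have [a0|a0] := eqVneq ((M : 'M[R]_(1 + n)) 0 0) 0; last exact: corner.
have ME := block_pivot (M : 'M[R]_(1 + n)); rewrite a0 in ME.
set r := ursubmx (M : 'M[R]_(1 + n)) in ME.
have [j rj] : exists j, r 0 j != 0.
  apply/existsP; apply: contraLR Mu => /existsPn r0.
  have r00 : r = 0 by apply/rowP => j; rewrite [RHS]mxE; apply/eqP/negPn/r0.
  rewrite unitmxE unitfE negbK; apply/det0P.
  exists (row_mx 1%:M 0 : 'rV[R]_(1 + n)).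
    apply/eqP => /(congr1 (fun A : 'rV[R]_(1 + n) => lsubmx A 0 0))/eqP.
    by rewrite row_mxKl !mxE /= oner_eq0.
  suff : (row_mx 1%:M 0 : 'rV[R]_(1 + n)) *m (M : 'M[R]_(1 + n)) = 0 by [].
  by rewrite ME mul_row_block !mul0mx !addr0 r00 raddf0 !mulmx0 row_mx0.
pose S e : 'M[R]_(1 + n) := block_mx 1%:M 0 (e *: delta_mx j 0) 1%:M.
have SS : S 1 *m S (- 1) = 1%:M.
  rewrite mulmx_block !mul0mx !mulmx0 !mul1mx !mulmx1 !addr0 add0r.
  by rewrite -scalerDl subrr scale0r -scalar_mx_block.
have detS e : \det (S e) = 1 by rewrite det_lblock !det1 mulr1.
have -> : affine M b = affine (S (-1)) (row_mx 0%:M 0 : 'rV[R]_(1 + n)) \o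
    affine (M *m S 1) (b *m S 1).
  rewrite affine_comp -!mulmxA SS !mulmx1.
  by rewrite raddf0 row_mx0 addr0.
have -> : \det M = \det (M *m S 1) * 1 by rewrite det_mulmx detS !mulr1.
apply: scales_comp; last exact/scales_shear_first/oner_neq0.
apply: corner.
  have -> : M *m S 1 = (M : 'M[R]_(1 + n)) *m S 1 by [].
  rewrite ME mulmx_block block_pivot00 mul_scalar_mx scale0r add0r scale1r
    -colE.
  by rewrite mxE.
by rewrite unitmx_mul Mu unitmxE detS unitr1.
Qed.

End LebesgueTuple.

(** * Volume of the standard simplex *)

Section StandardSimplex.
Context {R : realType}.
Local Notation T := (measurableTypeR R).
Local Notation mu := (@lebesgue_measure R).

Lemma integral_power n (s : R) : 0 < s ->
  (\int[mu]_(x in `[0%R, s]) ((s - x) ^+ n / n`!%:R)%:E =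
   (s ^+ n.+1 / n.+1`!%:R)%:E)%E.
Proof.
move=> s0; pose P : {poly R} := - (n.+1`!%:R^-1 *: (s%:P - 'X) ^+ n.+1).
have PE (x : R) : P.[x] = - ((s - x) ^+ n.+1 / n.+1`!%:R).
  by rewrite /P !(hornerE, horner_exp) mulrC.
have P'E (x : R) : P^`().[x] = (s - x) ^+ n / n`!%:R.
  rewrite /P derivN derivZ deriv_exp derivB derivC derivX sub0r /=.
  rewrite !(hornerE, horner_exp, hornerMn) factS natrM.
  rewrite -mulr_natr; field.
  by rewrite nat1r !pnatr_eq0 -!lt0n fact_gt0.
have dP (x : R) : is_derive x 1 (horner P) P^`().[x] by exact: is_derive_poly.
have cP : continuous (horner P) by move=> x; exact: continuous_horner.
transitivity (\int[mu]_(x in `[0%R, s]) (P^`().[x])%:E)%E.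
  by apply: eq_integral => x _; rewrite P'E.
rewrite (@continuous_FTC2 _ (horner P^`()) (horner P)) //.
- by rewrite -EFinB !PE subrr subr0 expr0n /= mul0r oppr0 sub0r opprK.
- by apply: continuous_subspaceT => x; exact: continuous_horner.
- split=> [x _||]; first by have := dP x; case.
    by apply: cvg_at_right_filter; exact: cP.
  by apply: cvg_at_left_filter; exact: cP.
by move=> x _; rewrite derive1E; have := dP x; case.
Qed.

Definition std_simplex n (s : R) : set (n.-tuple T) :=
  [set t | (forall i, 0 <= tnth t i) /\ \sum_i tnth t i <= s].

Lemma std_simplex_cons n s x (t : n.-tuple T) :
  std_simplex s (cons_tuple (x, t)) <-> 0 <= x /\ std_simplex (s - x) t.
Proof.
rewrite /std_simplex /= big_ord_recl /= lerBrDl; under eq_bigr do rewrite tnthS.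
split=> [[t0 ts]|[x0 [t0 ts]]]; split=> //.
- exact: (t0 ord0).
- by split=> // i; have := t0 (lift ord0 i); rewrite tnthS.
by move=> i; have [j ->|->] := unliftP ord0 i; rewrite ?tnthS.
Qed.

Lemma measurable_std_simplex n s : measurable (@std_simplex n s).
Proof.
have -> : @std_simplex n s =
    (\bigcap_(i in [set: 'I_n])
       ((fun t : n.-tuple T => tnth t i) @^-1` `[0, +oo[)) `&`
    ((fun t : n.-tuple T => \sum_i tnth t i : T) @^-1` `]-oo, s]).
  apply/seteqP; split=> t /=; rewrite in_itv /=.
    by move=> [t0 ts]; split=> // i _; rewrite /= in_itv /= andbT.
  by move=> [t0 ts]; split=> // i; have := t0 i I; rewrite /= in_itv /= andbT.
apply: measurableI.
  apply: fin_bigcap_measurable; first exact: finite_finset.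
  move=> i _; rewrite -[X in measurable X]setTI.
  by apply: measurable_tnth => //; exact: measurable_itv.
rewrite -[X in measurable X]setTI.
have mf : measurable_fun [set: n.-tuple T] (fun t => \sum_i tnth t i : T).
  by apply: measurable_sum => i; exact: measurable_tnth.
by apply: mf => //; exact: measurable_itv.
Qed.

(** The slice at first coordinate x is the simplex of size s - x. *)
Lemma lebesgue_std_simplex n (s : R) : 0 < s ->
  lebesgue_tuple n (std_simplex s) = (s ^+ n / n`!%:R)%:E.
Proof.
elim: n s => [|n IHn] s s0.
  rewrite expr0 fact0 divr1 /= diracE mem_set //.
  by split=> [[]//|]; rewrite big_ord0 ltW.
pose g x := lebesgue_tuple n [set t | std_simplex s (cons_tuple (x, t))].
have mg : measurable_fun setT g.
  by apply: measurable_section1; exact: measurable_std_simplex.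
have gE x : 0 <= x < s -> g x = ((s - x) ^+ n / n`!%:R)%:E.
  move=> /andP[x0 xs]; rewrite -IHn ?subr_gt0 //; congr (lebesgue_tuple n _).
  apply/seteqP; split=> t /=; first by case/std_simplex_cons.
  by move=> ct; apply/std_simplex_cons.
have g0 x : x \notin `[0, s] -> g x = 0%E.
  rewrite in_itv /= => xs; rewrite /g (_ : [set t | _] = set0) ?measure0 //.
  apply/seteqP; split=> t //= /std_simplex_cons[x0 [t0 ts]]; move: xs.
  rewrite x0 /= -ltNge => sx; have : 0 <= s - x.
    by apply: le_trans ts; apply: sumr_ge0 => i _; exact: t0.
  by rewrite subr_ge0 leNgt sx.
rewrite lebesgue_tupleS1 -/g -integral_power //.
transitivity (\int[mu]_(x in `[0%R, s]) g x)%E.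
  rewrite [RHS]integral_mkcond; apply: eq_integral => x _.
  rewrite patchE; case: ifPn => //; rewrite notin_setE /= => /negP.
  exact: g0.
rewrite -2?integral_itv_bndo_bndc.
- by apply: eq_integral => x; rewrite inE /= in_itv /=; exact: gE.
- apply: measurable_funTS; apply/measurable_EFinP.
  apply: measurable_funM => //; apply: measurable_funX.
  exact: measurable_funB.
- exact: measurable_funTS.
Qed.

End StandardSimplex.

(** * Simplices in barycentric coordinates *)

Section Simplex.
Context {R : realType} {d : nat}.
Implicit Types (v : 'I_d.+1 -> 'rV[R]_d) (x : 'rV[R]_d).

Definition convex_combinations n (v : 'I_n -> 'rV[R]_d) : set 'rV[R]_d :=
  [set x | exists c : 'I_n -> R,
    [/\ forall i, 0 <= c i, \sum_i c i = 1 & x = \sum_i c i *: v i]].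

Lemma convex_segment (A : set 'rV[R]_d) y z (t : R) : convex_set A ->
  A y -> A z -> 0 <= t -> t <= 1 -> A (t *: y + (1 - t) *: z).
Proof.
move=> cA Ay Az t0 t1.
by have := cA y z (Itv01 t0 t1); rewrite !inE; apply.
Qed.

Lemma convex_combinations_convex n (v : 'I_n -> 'rV[R]_d) :
  convex_set (convex_combinations v).
Proof.
move=> x y t; rewrite !inE => -[a [a0 a1 ->]] [b [b0 b1 ->]].
have t0 : 0 <= t%:num by [].
have t1 : t%:num <= 1 by [].
exists (fun i => t%:num * a i + (1 - t%:num) * b i); split.
- by move=> i; rewrite addr_ge0 ?mulr_ge0 ?subr_ge0.
- by rewrite big_split -!mulr_sumr /= a1 b1 !mulr1 addrCA subrr addr0.
transitivity (t%:num *: (\sum_i a i *: v i) + (1 - t%:num) *: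
  (\sum_i b i *: v i)) => //.
rewrite !scaler_sumr -big_split /=; apply: eq_bigr => i _.
by rewrite [RHS]scalerDl !scalerA; exact: erefl.
Qed.

Lemma convex_combination_mem (A : set 'rV[R]_d) n (v : 'I_n -> 'rV[R]_d) :
  convex_set A -> range v `<=` A -> convex_combinations v `<=` A.
Proof.
move=> cA; elim: n v => [|n IHn] v vA _ [c [c0 c1 ->]].
  by move: c1; rewrite big_ord0 => /eqP; rewrite eq_sym oner_eq0.
rewrite big_ord_recl; move: c1; rewrite big_ord_recl => c1.
have s0 : 0 <= \sum_(i < n) c (lift ord0 i) by apply: sumr_ge0.
have [s00|sn0] := eqVneq (\sum_(i < n) c (lift ord0 i)) 0.
  rewrite big1 => [|i _].
    rewrite addr0 (_ : c ord0 = 1) ?scale1r; last by rewrite -c1 s00 addr0.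
    by apply: vA; exists ord0.
  suff -> : c (lift ord0 i) = 0 by rewrite scale0r.
  by have /psumr_eq0P := s00; apply.
have -> : \sum_(i < n) c (lift ord0 i) *: v (lift ord0 i) = (1 - c ord0) *:
    \sum_(i < n) (c (lift ord0 i) / (\sum_(i < n) c (lift ord0 i))) *: v
      (lift ord0 i).
  rewrite -c1 [c ord0 + _]addrC addrK scaler_sumr; apply: eq_bigr => i _.
  by rewrite scalerA mulrCA mulfV ?mulr1.
apply: convex_segment => //; first by apply: vA; exists ord0.
  apply: (IHn (fun i => v (lift ord0 i))).
    by move=> _ [i _ <-]; apply: vA; exists (lift ord0 i).
  exists (fun i => c (lift ord0 i) / (\sum_(i < n) c (lift ord0 i)));
    split=> //.
    by move=> i; rewrite divr_ge0.
  by rewrite -mulr_suml mulfV.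
by rewrite -c1 lerDl.
Qed.

Lemma convex_hull_range n (v : 'I_n -> 'rV[R]_d) :
  convex_hull (range v) = convex_combinations v.
Proof.
apply/seteqP; split.
  apply: smallest_sub; first exact: convex_combinations_convex.
  move=> _ [i _ <-]; exists (fun j => (j == i)%:R); split=> [j||] //.
    by rewrite (bigD1 i) //= eqxx big1 ?addr0 // => j /negPf ->.
  by rewrite (bigD1 i) //= eqxx scale1r big1 ?addr0 // => j /negPf ->;
    rewrite scale0r.
move=> x vx A [cA vA]; exact: (convex_combination_mem cA vA).
Qed.

Definition edge_mx v : 'M[R]_d := \matrix_i (v (lift ord0 i) - v ord0).

(** Barycentric coordinates from coordinates on the edges at the vertex 0. *)
Definition bary_of (u : 'rV[R]_d) (i : 'I_d.+1) : R :=
  if unlift ord0 i is Some j then u 0 j else 1 - \sum_j u 0 j.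

Lemma bary_of0 u : bary_of u ord0 = 1 - \sum_j u 0 j.
Proof. by rewrite /bary_of unlift_none. Qed.

Lemma bary_ofS u j : bary_of u (lift ord0 j) = u 0 j.
Proof. by rewrite /bary_of liftK. Qed.

Lemma sum_bary_of u : \sum_i bary_of u i = 1.
Proof.
rewrite big_ord_recl bary_of0; under [X in _ + X]eq_bigr do rewrite bary_ofS.
by rewrite subrK.
Qed.

Lemma bary_of_comb v u : \sum_i bary_of u i *: v i = v ord0 + u *m edge_mx v.
Proof.
rewrite big_ord_recl bary_of0; under [X in _ + X]eq_bigr do rewrite bary_ofS.
rewrite scalerBl scale1r -addrA; congr (_ + _).
rewrite mulmx_sum_row scaler_suml -sumrN -big_split /=.
by apply: eq_bigr => j _; rewrite rowK scalerBr addrC.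
Qed.

Lemma edge_mx_unit v : affinely_independent v -> edge_mx v \in unitmx.
Proof.
move=> vfree; rewrite unitmxE unitfE; apply/negP => /det0P[u u0 uW].
case/eqP: u0; apply/rowP => j; rewrite [RHS]mxE.
have := vfree (fun i => bary_of u i - bary_of 0 i) _ _ (lift ord0 j).
rewrite !bary_ofS mxE subr0; apply.
  by rewrite sumrB !sum_bary_of subrr.
under eq_bigr do rewrite scalerBl.
by rewrite sumrB !bary_of_comb uW mul0mx subrr.
Qed.

Definition bary v x : 'I_d.+1 -> R :=
  bary_of ((x - v ord0) *m invmx (edge_mx v)).

Lemma sum_bary v x : \sum_i bary v x i = 1.
Proof. exact: sum_bary_of. Qed.

Lemma bary_comb v x : affinely_independent v -> \sum_i bary v x i *: v i = x.
Proof.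
by move=> /edge_mx_unit vu; rewrite bary_of_comb mulmxKV // addrC subrK.
Qed.

Lemma bary_uniq v (c : 'I_d.+1 -> R) : affinely_independent v ->
  \sum_i c i = 1 -> bary v (\sum_i c i *: v i) = c.
Proof.
move=> vfree c1; apply/funext => i; apply/eqP; rewrite -subr_eq0; apply/eqP.
apply: (vfree (fun i => bary v (\sum_i c i *: v i) i - c i)).
  by rewrite sumrB sum_bary c1 subrr.
under eq_bigr do rewrite scalerBl.
by rewrite sumrB bary_comb // subrr.
Qed.

Lemma mem_simplex v x : affinely_independent v ->
  convex_hull (range v) x <-> forall i, 0 <= bary v x i.
Proof.
move=> vfree; rewrite convex_hull_range; split=> [[c [c0 c1 ->]] i|x0].
  by rewrite bary_uniq.
by exists (bary v x); split; rewrite ?sum_bary ?bary_comb.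
Qed.

Lemma bary_vertex v i : affinely_independent v ->
  bary v (v i) = fun j => (j == i)%:R.
Proof.
move=> vfree; rewrite -[RHS](bary_uniq vfree).
  by congr bary; rewrite (bigD1 i) //= eqxx scale1r big1 ?addr0 // =>
    j /negPf ->; rewrite scale0r.
by rewrite (bigD1 i) //= eqxx big1 ?addr0 // => j /negPf ->.
Qed.

Lemma bary_segment v y z (t : R) : affinely_independent v ->
  bary v (t *: y + (1 - t) *: z) =
  fun i => t * bary v y i + (1 - t) * bary v z i.
Proof.
move=> vfree; rewrite -[RHS](bary_uniq vfree).
  congr bary; rewrite -{1}(bary_comb y vfree) -{1}(bary_comb z vfree).
  rewrite !scaler_sumr -big_split; apply: eq_bigr => i _.
  by rewrite [RHS]scalerDl !scalerA; exact: erefl.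
by rewrite big_split -!mulr_sumr /= !sum_bary !mulr1 addrCA subrr addr0.
Qed.

Lemma bary_inj v x y : affinely_independent v -> bary v x = bary v y -> x = y.
Proof. by move=> vfree xy; rewrite -(bary_comb x vfree) xy bary_comb. Qed.

(** A point x with a coordinate strictly between 0 and 1 lies on the segment
    from that vertex to the point z of the opposite face, so it is not
    extreme. *)
Lemma vertices_simplex v : affinely_independent v ->
  vertices (convex_hull (range v)) = range v.
Proof.
move=> vfree; apply/seteqP;
  split=> [x [/(mem_simplex _ vfree) x0 ext]|_ [i _ <-]].
  have [i xi] : exists i, bary v x i != 0.
    apply/existsP; apply: contraT => /existsPn all0; have := sum_bary v x.
    rewrite big1 => [/eqP|i _]; first by rewrite eq_sym oner_eq0.
    exact/eqP/negPn/all0.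
  have xi0 : 0 < bary v x i by rewrite lt_def xi x0.
  have [xi1|xi1] := eqVneq (bary v x i) 1.
    exists i => //; apply: (bary_inj vfree); rewrite bary_vertex //.
    apply/funext => j; have [->|ji] := eqVneq j i; first by rewrite xi1.
    have := sum_bary v x; rewrite (bigD1 i) //= xi1 => /eqP.
    rewrite -[X in _ == X]addr0 (inj_eq (addrI _)) psumr_eq0 // => /allP/(_ j).
    by rewrite mem_index_enum ji => /(_ isT)/eqP ->.
  have rest : \sum_(j | j != i) bary v x j = 1 - bary v x i.
    by have := sum_bary v x; rewrite (bigD1 i) //= => /(canRL (addKr _)) ->;
      rewrite addrC.
  have lt1 : bary v x i < 1.
    by rewrite lt_neqAle xi1 /= -subr_ge0 -rest sumr_ge0.
  pose b := bary v x i; have b1 : 1 - b != 0 by rewrite subr_eq0 eq_sym.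
  pose z := \sum_j (if j == i then 0 else bary v x j / (1 - b)) *: v j.
  have zE : bary v z = fun j => if j == i then 0 else bary v x j / (1 - b).
    apply: bary_uniq => //; rewrite (bigD1 i) //= eqxx add0r.
    rewrite (eq_bigr (fun j => bary v x j / (1 - b)));
      last by move=> j /negPf ->.
    by rewrite -mulr_suml rest mulfV.
  have [] := ext (v i) z b.
  - by apply/mem_simplex => // j; rewrite bary_vertex // ler0n.
  - apply/mem_simplex => // j; rewrite zE; case: ifP => // _.
    by rewrite divr_ge0 // subr_ge0 ltW.
  - by rewrite xi0.
  - apply: (bary_inj vfree); rewrite bary_segment // bary_vertex // zE.
    apply/funext => j; case: eqVneq => [->|_];
      first by rewrite mulr1 mulr0 addr0.
    by rewrite mulr0 add0r mulrCA mulfV // mulr1.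
  by move=> vx _; exists i.
split; first by apply/mem_simplex => // j; rewrite bary_vertex // ler0n.
suff key (y z : 'rV[R]_d) (t : R) : convex_hull (range v) y ->
    convex_hull (range v) z -> 0 < t -> t < 1 -> v i = t *: y + (1 - t) *: z ->
      y = v i.
  move=> y z t hy hz /andP[t0 t1] E; split; first exact: (key y z t).
  by apply: (key z y (1 - t)) => //;
    rewrite ?subr_gt0 ?ltrBlDr ?ltrDl // E addrC subKr.
move=> /(mem_simplex _ vfree) y0 /(mem_simplex _ vfree) z0 t0 t1 E.
have [t0' t1'] := (ltW t0, ltW t1).
have yj j : j != i -> bary v y j = 0.
  move=> ji; have := bary_vertex i vfree;
    rewrite E bary_segment // => /(congr1 (@^~ j)) /=.
  rewrite (negPf ji) => /eqP;
    rewrite [X in _ == X](_ : _ = 0) // paddr_eq0 ?mulr_ge0 ?subr_ge0 //.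
  by rewrite mulf_eq0 gt_eqF //= => /andP[/eqP].
apply: (bary_inj vfree); rewrite bary_vertex //; apply/funext => j.
have [->|/yj //] := eqVneq j i.
by have := sum_bary v y; rewrite (bigD1 i) //= big1 ?addr0 // => l /yj.
Qed.

Lemma interior_simplex v x : affinely_independent v ->
  interior (convex_hull (range v)) x -> forall i, 0 < bary v x i.
Proof.
move=> vfree xI i; have xT : convex_hull (range v) x by exact: interior_subset.
have := (mem_simplex x vfree).1 xT i; rewrite le_eqVlt => /orP[/eqP xi0|//].
exfalso.
(* moving away from the opposite vertex leaves the simplex at once *)
pose g (e : R) := x + e *: (x - v i).
have gE e : g e = - e *: v i + (1 - - e) *: x.
  by rewrite /g opprK scalerDl scale1r scalerBr scaleNr [RHS]addrC addrA.
have cg : {for 0, continuous g}.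
  apply: cvgD; first exact: cvg_cst.
  by apply: cvgZl; exact: cvg_id.
have gx : nbhs (g 0) (convex_hull (range v)).
  by rewrite /g scale0r addr0.
have near0 : \forall e \near 0^'+, convex_hull (range v) (g e).
  by apply: cvg_at_right_filter gx; exact: cg.
have [e [ge e0]] : exists e, convex_hull (range v) (g e) /\ 0 < e.
  by apply: (@filter_ex _ (0 : R)^'+); apply: filterI near0 (nbhs_right_gt _).
have ge0 := (mem_simplex _ vfree).1 ge i.
move: ge0; rewrite gE bary_segment // bary_vertex // eqxx -xi0 mulr1 mulr0
  addr0.
by rewrite oppr_ge0 leNgt e0.
Qed.

Lemma preimage_std_simplex v : affinely_independent v ->
  [set t | convex_hull (range v) (row_of t)] =
  affine (invmx (edge_mx v)) (- v ord0 *m invmx (edge_mx v)) @^-1`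
    std_simplex 1.
Proof.
move=> vfree; apply/seteqP; split=> t; rewrite /std_simplex /affine /= -mulmxDl.
  move=> /(mem_simplex _ vfree) t0; split=> [i|].
    by rewrite tnth_mktuple; have := t0 (lift ord0 i); rewrite /bary bary_ofS.
  under eq_bigr do rewrite tnth_mktuple.
  by have := t0 ord0; rewrite /bary bary_of0 subr_ge0.
move=> [t0 t1]; apply/(mem_simplex _ vfree) => i; rewrite /bary.
have [j ->|->] := unliftP ord0 i.
  by rewrite bary_ofS; have := t0 j; rewrite tnth_mktuple.
rewrite bary_of0 subr_ge0; move: t1.
by under eq_bigr do rewrite tnth_mktuple.
Qed.

(** The coordinates on the edges map the simplex onto the standard one. *)
Lemma Vol_simplex v : affinely_independent v ->
  Vol (convex_hull (range v)) = (`|\det (edge_mx v)| / d`!%:R)%:E.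
Proof.
move=> vfree; have Wu := edge_mx_unit vfree.
have W0 : `|\det (edge_mx v)| != 0 by rewrite normr_eq0 -unitfE -unitmxE.
have Wiu : invmx (edge_mx v) \in unitmx by rewrite unitmx_inv.
have [_ /(_ _ (measurable_std_simplex 1))] :=
  scales_affine (- v ord0 *m invmx (edge_mx v)) Wiu.
rewrite -preimage_std_simplex // lebesgue_std_simplex // expr1n det_inv normfV.
rewrite -/(Vol (convex_hull (range v))) => E.
transitivity (`|\det (edge_mx v)|%:E * (1 / d`!%:R)%:E)%E.
  by rewrite -E muleA -EFinM mulfV // mul1e.
by rewrite -EFinM mulrA mulr1.
Qed.

End Simplex.

(** * The simplices S_d(k) *)

(** Both sides are the determinant of the same block matrix, eliminated from its
    upper left or from its lower right corner. *)
Lemma det_rank1_update (A : comRingType) n (c : 'cV[A]_n) (r : 'rV[A]_n) :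
  \det (1%:M + c *m r) = 1 + (r *m c) 0 0.
Proof.
pose B : 'M[A]_(1 + n) := block_mx 1%:M (- r) c 1%:M.
have B1 : B = block_mx 1%:M 0 c 1%:M *m block_mx 1%:M (- r) 0 (1%:M + c *m r).
  rewrite mulmx_block !mul1mx !mul0mx !mulmx1 ?mulmx0 !addr0 mulmxN.
  by rewrite addrC addrK.
have B2 : B = block_mx (1%:M + r *m c) (- r) 0 1%:M *m block_mx 1%:M 0 c 1%:M.
  rewrite mulmx_block !mul1mx !mul0mx !mulmx1 ?mulmx0 ?add0r mulNmx.
  by rewrite addrK.
have D1 : \det B = \det (1%:M + c *m r).
  by rewrite B1 det_mulmx det_lblock det_ublock !det1 !mul1r.
have D2 : \det B = \det (1%:M + r *m c).
  by rewrite B2 det_mulmx det_lblock det_ublock !det1 !mulr1.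
by rewrite -D1 D2 [X in \det X]mx11_scalar det_scalar1 !mxE eqxx.
Qed.

Section Standard.
Context (R : realType) (d k : nat).

Lemma affinely_independent_edge_mx (v : 'I_d.+1 -> 'rV[R]_d) :
  edge_mx v \in unitmx -> affinely_independent v.
Proof.
move=> vu c c0 cv.
pose u : 'rV[R]_d := \row_j c (lift ord0 j).
have cE : c ord0 = - \sum_j u 0 j.
  apply/eqP; rewrite -addr_eq0 -[X in _ == X]c0 big_ord_recl; apply/eqP.
  by congr (_ + _); apply: eq_bigr => j _; rewrite mxE.
have u0 : u = 0.
  rewrite -[u](mulmxK vu) (_ : u *m _ = 0) ?mul0mx // -cv big_ord_recl cE.
  rewrite mulmx_sum_row scaleNr scaler_suml addrC -sumrB; apply: eq_bigr => j _.
  by rewrite rowK scalerBr !mxE.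
move=> i; have [j ->|->] := unliftP ord0 i.
  by have /rowP/(_ j) := u0; rewrite !mxE.
by rewrite cE u0 big1 ?oppr0 // => j _; rewrite mxE.
Qed.

Definition standard_vertex (i : 'I_d.+1) : 'rV[R]_d :=
  if unlift ord0 i is Some j then delta_mx 0 j
  else - (k%:R *: \sum_(j < d) delta_mx 0 j).

Lemma standard_vertex0 :
  standard_vertex ord0 = - (k%:R *: \sum_(j < d) delta_mx 0 j).
Proof. by rewrite /standard_vertex unlift_none. Qed.

Lemma standard_vertexS j : standard_vertex (lift ord0 j) = delta_mx 0 j.
Proof. by rewrite /standard_vertex liftK. Qed.

Lemma simplex_SE : simplex_S R d k = convex_hull (range standard_vertex).
Proof.
congr convex_hull; apply/seteqP; split=> [_ [[j _ <-]|->]|_ [i _ <-]].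
- by exists (lift ord0 j); rewrite ?standard_vertexS.
- by exists ord0; rewrite ?standard_vertex0.
have [j ->|->] := unliftP ord0 i.
  by left; exists j; rewrite ?standard_vertexS.
by right; rewrite standard_vertex0.
Qed.

Lemma det_standard : \det (edge_mx standard_vertex) = (d * k + 1)%:R.
Proof.
have -> : edge_mx standard_vertex =
  1%:M + (const_mx k%:R : 'cV_d) *m (const_mx 1 : 'rV_d).
  apply/matrixP => i j; rewrite !mxE standard_vertexS standard_vertex0.
  rewrite !mxE opprK eqxx /= eq_sym big_ord1 !mxE mulr1; congr (_ + _).
  rewrite summxE (bigD1 j) //= mxE !eqxx big1 ?addr0 ?mulr1 // => l /negPf lj.
  by rewrite mxE eq_sym lj andbF.
rewrite det_rank1_update mxE; under eq_bigr do rewrite !mxE mul1r.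
by rewrite sumr_const card_ord -mulrnA natrD addrC mulnC.
Qed.

Lemma unimodular_image_hull n (v : 'I_n -> 'rV[R]_d)
    (M : 'M[int]_d) (u : 'rV[int]_d) :
  unimodular_map M u @` convex_hull (range v) =
  convex_hull (range (fun i => unimodular_map M u (v i))).
Proof.
rewrite !convex_hull_range.
have comb (c : 'I_n -> R) : \sum_i c i = 1 ->
    unimodular_map M u (\sum_i c i *: v i) =
    \sum_i c i *: unimodular_map M u (v i).
  move=> c1; rewrite /unimodular_map; under [RHS]eq_bigr do rewrite scalerDr.
  rewrite big_split /= -scaler_suml c1 scale1r mulmx_suml; congr (_ + _).
  by apply: eq_bigr => i _; rewrite scalemxAl.
apply/seteqP; split=> [_ [_ [c [c0 c1 ->]] <-]|_ [c [c0 c1 ->]]].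
  by exists c; rewrite comb.
by exists (\sum_i c i *: v i); [exists c|rewrite comb].
Qed.

Lemma edge_mx_unimodular (v : 'I_d.+1 -> 'rV[R]_d)
    (M : 'M[int]_d) (u : 'rV[int]_d) :
  edge_mx (fun i => unimodular_map M u (v i)) = edge_mx v *m map_mx intr M.
Proof.
apply/row_matrixP => i; rewrite rowK row_mul rowK /unimodular_map.
by rewrite opprD addrACA subrr addr0 mulmxBl.
Qed.

Lemma equivalent_Vol (T : set 'rV[R]_d) : equivalent T (simplex_S R d k) ->
  Vol T = (1 / d`!%:R * (d * k + 1)%N%:R)%:E.
Proof.
move=> [M [u [detM ->]]]; rewrite simplex_SE unimodular_image_hull.
set w := fun i => _.
have normM : `|\det (map_mx intr M : 'M[R]_d)| = 1.
  by rewrite det_map_mx; case: detM => ->;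
    rewrite ?rmorphN rmorph1 ?normrN normr1.
have detw : `|\det (edge_mx w)| = (d * k + 1)%:R.
  by rewrite edge_mx_unimodular det_mulmx normrM normM mulr1 det_standard
    normr_nat.
have wfree : affinely_independent w.
  by apply: affinely_independent_edge_mx;
    rewrite unitmxE unitfE -normr_eq0 detw pnatr_eq0 addn1.
by rewrite Vol_simplex // detw div1r mulrC.
Qed.

End Standard.

(** * Clean simplices of minimal volume *)

Lemma natrS_neq0 (R : realType) n : n.+1%:R != 0 :> R.
Proof. by rewrite pnatr_eq0. Qed.

Section LatticeSimplex.
Context (R : realType) (d k : nat).
Variables (v : 'I_d.+1 -> 'rV[R]_d) (V : 'I_d.+1 -> 'rV[int]_d).
Hypothesis vfree : affinely_independent v.
Hypothesis vE : forall i, v i = map_mx intr (V i).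
Let T := convex_hull (range v).
Local Notation N := (d * k).+1.
Local Notation G := (lattice_group (d * k) V).
Local Notation f := (fun i (c : 'rV['I_N]_d.+1) => c ord0 i : nat).
Hypothesis detV : `|\det (edge_int V)|%N = N.

Lemma edge_mxE : edge_mx v = map_mx intr (edge_int V).
Proof.
by apply/row_matrixP => i; rewrite rowK -map_row rowK !vE map_mxB.
Qed.

Lemma card_lattice_group_le : (#|G| <= N)%N.
Proof.
apply: leq_trans (card_lattice_group _ _) _; last by rewrite detV.
by rewrite -absz_gt0 detV.
Qed.

Definition group_point (c : 'rV['I_N]_d.+1) : 'rV[R]_d :=
  \sum_i ((c ord0 i : nat)%:R / N%:R) *: v i.

Lemma sum_group_bary c : (\sum_i f i c = N)%N ->
  \sum_i ((c ord0 i : nat)%:R / N%:R) = 1 :> R.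
Proof. by move=> cN; rewrite -mulr_suml -natr_sum cN mulfV ?natrS_neq0. Qed.

Lemma bary_group_point c : (\sum_i f i c = N)%N ->
  bary v (group_point c) = fun i => (c ord0 i : nat)%:R / N%:R.
Proof. by move=> cN; apply: bary_uniq => //; exact: sum_group_bary. Qed.

Lemma sum_int_vertices (a : 'I_d.+1 -> int) :
  \sum_i (a i)%:~R *: v i = map_mx intr (\sum_i a i *: V i) :> 'rV[R]_d.
Proof.
by rewrite map_mx_sum; apply: eq_bigr => i _; rewrite map_mxZ vE.
Qed.

Lemma group_point_lattice c : c \in G -> lattice (group_point c).
Proof.
move=> /lattice_groupP[_ /dvd_rowP cV] l.
have -> : group_point c =
  N%:R^-1 *: map_mx intr (\sum_i (c ord0 i : nat)%:Z *: V i).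
  rewrite -sum_int_vertices scaler_sumr; apply: eq_bigr => i _.
  by rewrite scalerA mulrC.
rewrite !mxE; have /dvdzP[q ->] := cV l.
by rewrite rmorphM /= mulrC mulfK ?natrS_neq0 // intr_int.
Qed.

Hypothesis T_clean : clean T.

(** A point with a zero coordinate is on the boundary, and it is no vertex
    because all its coordinates are less than N. *)
Lemma clean_coord_gt0 c i : c \in height1 N G f -> (0 < f i c)%N.
Proof.
have rgG := lattice_group_rg (d * k) V.
move=> /(height1P rgG)[cG cN]; rewrite lt0n; apply/negP => /eqP ci0.
have pT : T (group_point c).
  by apply/mem_simplex => // j; rewrite bary_group_point // divr_ge0.
have pbd : boundary T (group_point c).
  split; first exact: subset_closure.
  move=> /(interior_simplex vfree)/(_ i).
  by rewrite bary_group_point // ci0 mul0r ltxx.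
have := T_clean (conj pbd (group_point_lattice cG)).
rewrite vertices_simplex // => -[m _ vm].
have := bary_vertex m vfree;
  rewrite vm bary_group_point // => /(congr1 (@^~ m)) /=.
rewrite eqxx => /(canRL (divfK (natrS_neq0 R _))); rewrite mul1r => /eqP.
by rewrite eqr_nat ltn_eqF.
Qed.

(** Cramer's rule: the edge matrix has determinant N or - N. *)
Lemma bary_int x i : lattice x -> N%:R * bary v x i \is a Num.int.
Proof.
move=> xL.
have vu := edge_mx_unit vfree.
have dE : \det (edge_mx v) =
  (\det (edge_int V))%:~R by rewrite edge_mxE det_map_mx.
have u_int (j : 'I_d) : N%:R * ((x - v ord0) *m invmx (edge_mx v)) 0 j \is a
  Num.int.
  rewrite /invmx vu -scalemxAr mxE mulrA dE rpredM //.
    have [->|->] : \det (edge_int V) = N%:Z \/ \det (edge_int V) = - N%:Z.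
      by move: detV; lia.
    - by rewrite mulfV ?natrS_neq0 // rpred1.
    by rewrite rmorphN invrN mulrN mulfV ?natrS_neq0 // rpredN rpred1.
  rewrite edge_mxE -map_mx_adj mxE; apply: rpred_sum => l _; apply: rpredM.
    by rewrite !mxE vE mxE rpredB // intr_int.
  by rewrite mxE intr_int.
have [j ->|->] := unliftP ord0 i; first by rewrite /bary bary_ofS.
rewrite /bary bary_of0 mulrBr mulr1 rpredB ?natr_int // mulr_sumr.
by apply: rpred_sum => j _; exact: u_int.
Qed.

Hypothesis d_gt0 : (0 < d)%N.

Lemma interior_point_code x : interior T x -> lattice x ->
  exists2 c, c \in height1 N G f &
    forall i, (f i c)%:R = N%:R * bary v x i.
Proof.
move=> xT xL; have x0 := interior_simplex vfree xT.
have /boolp.choice[z zE] : forall i, exists z : int, N%:R * bary v x i = z%:~R.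
  by move=> i; apply/intrP; exact: bary_int.
have z0 i : 0 < z i by rewrite -(@ltr0z R) -zE mulr_gt0 ?x0 // ltr0n.
have sumz : \sum_i z i = N%:Z.
  apply: (@intr_inj R); rewrite rmorph_sum /=; under eq_bigr do rewrite -zE.
  by rewrite -mulr_sumr sum_bary mulr1.
have zN i : z i < N%:Z.
  rewrite -sumz (bigD1 i) //= ltrDl.
  have [j ji] : exists j, j != i.
    have : (0 < #|[set~ i]%SET|)%N by have := cardsC1 i; rewrite card_ord /=;
      lia.
    by case/card_gt0P => j; rewrite !inE => ji; exists j.
  rewrite (bigD1 j) //= ltr_pwDl //; apply: sumr_ge0 => l _; exact: ltW.
pose c : 'rV['I_N]_d.+1 := \row_i inord `|z i|%N.
have cz i : (f i c)%:Z = z i.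
  rewrite mxE inordK; last by have := zN i; have := z0 i; lia.
  by rewrite gez0_abs // ltW.
have cE i : (f i c)%:R = N%:R * bary v x i :> R.
  by rewrite zE -cz.
have cN : (\sum_i f i c = N)%N.
  apply/eqP; rewrite -(eqr_nat int) natr_sum [X in _ == X]natz -sumz; apply/eqP.
  by apply: eq_bigr => i _; rewrite -cz natz.
exists c => //; apply/(height1P (lattice_group_rg _ V)); split=> //.
apply/lattice_groupP; rewrite cN; split=> //; apply/dvd_rowP => l.
have /intrP[q qE] := xL l.
apply/dvdzP; exists q; apply: (@intr_inj R).
have -> : ((\sum_i (f i c)%:Z *: V i) 0 l)%:~R =
    (map_mx intr (\sum_i (f i c)%:Z *: V i) : 'rV[R]_d) 0 l.
  by rewrite mxE.
rewrite -sum_int_vertices rmorphM /= -qE mulrC -{1}(bary_comb x vfree).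
rewrite [RHS](_ : _ = (N%:R *: \sum_i bary v x i *: v i) 0 l);
  last by rewrite mxE.
congr (fun_of_matrix _ 0 l); rewrite scaler_sumr; apply: eq_bigr => i _.
by rewrite scalerA -cE.
Qed.

Hypothesis T_count : (interior T `&` lattice #= `I_k)%card.

Lemma card_height1_ge : (k <= #|height1 N G f|)%N.
Proof.
have /card_esym/card_set_bijP[g [gI ginj _]] := T_count.
have /boolp.choice[h hP] : forall i : 'I_k, exists c, c \in height1 N G f /\
    forall j, (f j c)%:R = N%:R * bary v (g i) j.
  move=> i; have [|gT gL] := gI i; first exact: ltn_ord.
  by have [c cH cE] := interior_point_code gT gL; exists c.
rewrite -[X in (X <= _)%N]card_ord -(card_imset (f := h)).
  apply: subset_leq_card; apply/fintype.subsetP => c /imsetP[i _ ->].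
  by case: (hP i).
move=> i j hij; apply/val_inj/ginj; rewrite ?inE //=; try exact: ltn_ord.
apply: (bary_inj vfree); apply/funext => l.
have [_ /(_ l) E] := hP i; have [_ /(_ l) E'] := hP j.
by apply: (mulfI (natrS_neq0 R (d * k))); rewrite -E -E' hij.
Qed.

(** 1 + d * #|H1| <= #|G| <= N = d k + 1 and k <= #|H1| leave no choice. *)
Lemma lattice_group_extremal : extremal_residue_group N G f.
Proof.
have rgG := lattice_group_rg (d * k) V.
have H1d c : c \in height1 N G f -> height N f (- c) = d.
  move=> cH; rewrite (height_opp_full rgG cH) ?card_ord // => i.
  exact: clean_coord_gt0.
have le := card_residue_group rgG;
  rewrite (eq_bigr (fun=> d)) // sum_nat_const in le.
have ge := card_height1_ge; have leG := card_lattice_group_le.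
have kH : #|height1 N G f| = k.
  apply/eqP; rewrite eqn_leq ge andbT -(leq_pmul2r d_gt0).
  by move: le leG; move: #|lattice_group _ _| => a; lia.
split=> //; first by move=> c i; exact: clean_coord_gt0.
  by apply/eqP; rewrite eqn_leq leG /=; move: le; rewrite kH mulnC add1n.
by rewrite card_ord kH.
Qed.

End LatticeSimplex.

(** * Recognition of S_d(k) *)

Lemma affinely_independent_perm (R : realType) d n (v : 'I_n -> 'rV[R]_d)
    (s : {perm 'I_n}) :
  affinely_independent v -> affinely_independent (v \o s).
Proof.
move=> vfree c c0 cv i.
have -> : c i = c ((s^-1)%g (s i)) by rewrite permK.
apply: (vfree (fun j => c ((s^-1)%g j))).
  by rewrite (reindex_perm s) /=; under eq_bigr do rewrite permK.
by rewrite (reindex_perm s) /=; under eq_bigr do rewrite permK.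
Qed.

Lemma range_perm (T : Type) n (v : 'I_n -> T) (s : {perm 'I_n}) :
  range (v \o s) = range v.
Proof.
apply/seteqP; split=> [_ [i _ <-]|_ [i _ <-]]; first by exists (s i).
by exists ((s^-1)%g i); rewrite //= permKV.
Qed.

Section Recognition.
Context (R : realType) (d k : nat).
Variables (v : 'I_d.+1 -> 'rV[R]_d) (V : 'I_d.+1 -> 'rV[int]_d).
Hypothesis vE : forall i, v i = map_mx intr (V i).
Local Notation N := (d * k).+1.

(** The affine map that sends the vertices of S_d(k) to those of the simplex is
    x |-> x M + Z, where Z is the image of the origin, whose coordinates in
    S_d(k) are 1/N at the vertex - k (e_1 + ... + e_d) and k/N at each e_i. The
    determinants of the two edge matrices agree, so det M = 1 or - 1. *)
Lemma equivalent_of_center (Z : 'rV[int]_d) :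
    `|\det (edge_mx v)| = N%:R ->
    N%:Z *: Z = V ord0 + k%:Z *: \sum_l V (lift ord0 l) ->
  equivalent (convex_hull (range v)) (simplex_S R d k).
Proof.
move=> detv ZE; pose M : 'M[int]_d := \matrix_l (V (lift ord0 l) - Z).
have vert i : unimodular_map M Z (@standard_vertex R d k i) = v i.
  rewrite /unimodular_map vE; have [l ->|->] := unliftP ord0 i.
    by rewrite standard_vertexS -rowE -map_row rowK -map_mxD subrK.
  rewrite standard_vertex0 mulNmx -scalemxAl mulmx_suml.
  under eq_bigr do rewrite -rowE -map_row rowK.
  rewrite -map_mx_sum sumrB sumr_const card_ord.
  have -> : k%:R = (k%:Z)%:~R :> R by [].
  rewrite -map_mxZ -map_mxN -map_mxD; congr map_mx.
  apply/rowP => l; have /rowP/(_ l) := ZE; rewrite !mxE.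
  move: (\sum_(_ < _) _) => S E;
    have -> : V ord0 0 l = N%:Z * Z 0 l - k%:Z * S 0 l.
    by rewrite E addrK.
  have -> : N%:Z = d%:Z * k%:Z + 1 by rewrite -PoszM -PoszD addn1.
  by rewrite mulmxnE -mulr_natl natz; ring.
have vertE : (fun i => unimodular_map M Z (@standard_vertex R d k i)) = v.
  by apply/funext.
exists M, Z; split; last by rewrite simplex_SE unimodular_image_hull vertE.
have := congr1 (fun w => `|\det (edge_mx w)|) vertE.
rewrite edge_mx_unimodular det_mulmx normrM det_standard detv normr_nat addn1.
move=> /(canRL (mulKf _)) -/(_ (natrS_neq0 _ _));
  rewrite mulVf ?natrS_neq0 // det_map_mx.
rewrite -intr_norm => /eqP; rewrite -[1]/(1%:~R) eqr_int => /eqP; lia.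
Qed.

End Recognition.

Section Extract.
Context (d k : nat).
Variables (V : 'I_d.+1 -> 'rV[int]_d).
Local Notation N := (d * k).+1.

(** Take the multiple k c: its coordinate at j is 1 modulo N, because c_j = - d
    and - d k = 1 modulo N. *)
Lemma center_of_standard (c : 'rV['I_N]_d.+1) j :
    c \in lattice_group (d * k) V ->
    (forall i, i != j -> c ord0 i = 1%N :> nat) ->
  exists Z : 'rV[int]_d, N%:Z *: Z = V j + k%:Z *: \sum_(i | i != j) V i.
Proof.
move=> /lattice_groupP[]; rewrite (bigD1 j) //= => cN.
rewrite (bigD1 j) //= => cV c1.
have sum1 : (\sum_(i | i != j) c ord0 i = d)%N.
  rewrite (eq_bigr (fun=> 1%N)) // sum1_card.
  by have := cardC1 j; rewrite card_ord.
have sumV : \sum_(i | i != j) (c ord0 i : nat)%:Z *: V i =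
  \sum_(i | i != j) V i.
  by apply: eq_bigr => i ij; rewrite c1 // scale1r.
rewrite sum1 in cN; rewrite sumV in cV.
have : dvd_row (d * k) (V j + k%:Z *: \sum_(i | i != j) V i).
  have -> : V j + k%:Z *: \sum_(i | i != j) V i =
     k%:Z *: ((c ord0 j : nat)%:Z *: V j + \sum_(i | i != j) V i) +
     (1 - k%:Z * (c ord0 j : nat)%:Z) *: V j.
    by apply/rowP => l; rewrite !mxE; ring.
  apply: dvd_rowD; apply/dvd_rowP => l; rewrite mxE.
    by apply: dvdz_mull; move/dvd_rowP: cV.
  apply: dvdz_mulr.
  have /dvdnP[m mE] := cN.
  apply/dvdzP; exists (1 - k%:Z * m%:Z).
  have -> : (c ord0 j : nat)%:Z = m%:Z * N%:Z - d%:Z.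
    by rewrite -PoszM -mE PoszD addrK.
  by rewrite -addn1 PoszD PoszM; ring.
move=> /dvd_rowP VN; set Y := _ + _ in VN *.
exists (\row_(l < d) ((Y ord0 l)%R %/ N)%Z).
by apply/rowP => l; rewrite mxE [X in _ * X]mxE mulrC divzK.
Qed.
End Extract.

Theorem corollary7p3 (R : realType) (d k : nat) (hd : (3 <= d)%N)
    (hk : (1 <= k)%N) (T : set 'rV[R]_d)
    (hT : clean_lattice_simplices k T) :
  Vol T = (1 / d`!%:R * (d * k + 1)%N%:R)%:E <->
  equivalent T (simplex_S R d k).
Proof.
split; last exact: equivalent_Vol.
case: hT => -[[v vfree TE] vlat] Tclean Tcount VolT.
have [V vE] : exists V : 'I_d.+1 -> 'rV[int]_d,
    forall i, v i = map_mx intr (V i).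
  have H i : exists W : 'rV[int]_d, v i = map_mx intr W.
    have vi : lattice (v i).
      by apply: vlat; rewrite TE vertices_simplex //; exists i.
    have /boolp.choice[z zE] : forall l, exists z : int, v i 0 l = z%:~R.
      by move=> l; apply/intrP; exact: vi.
    by exists (\row_l z l); apply/rowP => l; rewrite !mxE zE.
  by have [V VE] := boolp.choice H; exists V.
have d0 : (0 < d)%N by lia.
have detR : `|\det (edge_mx v)| = (d * k).+1%:R.
  move: VolT; rewrite TE Vol_simplex // addn1 div1r mulrC => -[].
  by apply: mulfI; rewrite invr_neq0 // pnatr_eq0 -lt0n fact_gt0.
have detV : `|\det (edge_int V)|%N = (d * k).+1.
  move: detR; rewrite (edge_mxE vE) det_map_mx -intr_norm -abszE => /eqP.
  by rewrite eqr_nat => /eqP.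
rewrite TE in Tclean Tcount.
have xgG := lattice_group_extremal vfree vE detV Tclean d0 Tcount.
have [c cG [j cj]] : has_standard_point (lattice_group (d * k) V)
    (fun i (c : 'rV['I_(d * k).+1]_d.+1) => c ord0 i : nat).
  apply: (extremal_standard xgG (card_ord _) hd).
  by apply: leq_trans hk _; exact: card_height1_ge Tcount.
have [Z ZE] := center_of_standard cG cj.
(* relabel the vertices so that the exceptional one comes first *)
pose s := tperm ord0 j.
rewrite TE -(range_perm v s).
apply: (@equivalent_of_center _ _ _ (v \o s) (V \o s) _ Z).
- by move=> i; exact: vE.
- have := Vol_simplex (affinely_independent_perm (s := s) vfree).
  rewrite range_perm Vol_simplex // detR => -[].
  by move=> /(mulIf _) <- //; rewrite invr_neq0 // pnatr_eq0 -lt0n fact_gt0.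
rewrite ZE /= tpermL; congr (_ + _ *: _).
rewrite (reindex_perm s) /=.
rewrite (eq_bigl (fun i => i != ord0)); last first.
  by move=> i; rewrite -[in RHS](inj_eq (@perm_inj _ s)) tpermL.
rewrite big_mkcond big_ord_recl eqxx /= add0r.
by apply: eq_bigr.
Qed.
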